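(* Let $s \ge 1$. There is an algorithm which, given $k\in\mathbb{N}$ and a family of sets over an $n$-element universe in which each pair of distinct sets intersects in at most $s$ elements, uses $O(s^2 \log n)$ bits of auxiliary space and either correctly determines that the instance is a NO instance of Hitting Set, or outputs an equivalent instance of Hitting Set whose family consists of at most $k^{s+1}$ sets, each with at most $s k^{s+1}$ elements, in which each pair of distinct sets intersects in at most $s$ elements.
   Context: Hitting Set: given a finite universe $U$, a family $\mathcal{F}$ of subsets of $U$ and an integer $k$, decide whether some $H\subseteq U$ with $|H|\le k$ intersects every member of $\mathcal{F}$. Two instances are equivalent if both are YES instances or both are NO instances. Space model: the input is in read-only random-access memory, the output is written to a write-only stream, and only auxiliary read-write memory is counted. *)

(* Defs.v *)
From HB Require Import structures.
From mathcomp Require Import all_boot.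

Set Implicit Arguments.
Unset Strict Implicit.
Unset Printing Implicit Defensive.

Record hs_instance := HSInstance {
  univ : nat;
  fam : {set {set 'I_univ}};
  budget : nat
}.

Definition hs_yes (I : hs_instance) : Prop :=
  exists H : {set 'I_(univ I)},
    #|H| <= budget I /\ forall S, S \in fam I -> H :&: S != set0.

Definition hs_equiv (I J : hs_instance) : Prop := hs_yes I <-> hs_yes J.

Definition pairwise_meet_le (s : nat) (I : hs_instance) : Prop :=
  forall A B, A \in fam I -> B \in fam I -> A != B -> #|A :&: B| <= s.

(** Bit strings encoding instances: [n] in unary, then the rows of the incidence
    matrix (each of [n] bits and preceded by a marker [true]), an end marker
    [false], and [k] in unary.  A family is listed without repetition, in an
    arbitrary order. *)

Definition row_bits n (S : {set 'I_n}) : seq bool :=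
  [seq i \in S | i <- enum 'I_n].

Definition unary (n : nat) : seq bool := rcons (nseq n true) false.

Definition encode n (r : seq {set 'I_n}) (k : nat) : seq bool :=
  unary n ++ flatten [seq true :: row_bits A | A <- r] ++ false :: unary k.

Definition encodes (w : seq bool) (I : hs_instance) : Prop :=
  exists r : seq {set 'I_(univ I)},
    [/\ uniq r, r =i fam I & w = encode r (budget I)].

(** The machine model: deterministic programs over a finite set [V] of registers
    holding natural numbers.  The input is a read-only bit string, of which any
    bit can be read at an address held in a register; the output is a write-only
    stream of bits.  Every elementary instruction applies at most one arithmetic
    operation, so that no uncounted intermediate value is ever formed. *)

Inductive binop := Add | Sub | Mul | Div | Mod.

Definition binop_sem (o : binop) : nat -> nat -> nat :=
  match o with
  | Add => addn | Sub => subn | Mul => muln | Div => divn | Mod => modn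
  end.

Inductive rhs (V : Type) :=
  | Const of nat
  | Op of binop & V & V
  | ReadAt of V.

Inductive cmd (V : Type) :=
  | Skip
  | Assign of V & rhs V
  | Emit of bool
  | Seq of cmd V & cmd V
  | If of V & cmd V & cmd V
  | While of V & cmd V.

Arguments Const {V}.
Arguments Skip {V}.
Arguments Emit {V}.

(** Number of binary digits; at least 1, also for 0. *)
Definition nbits (n : nat) : nat := (trunc_log 2 n).+1.

Definition store (V : finType) := {ffun V -> nat}.

Definition store_bits (V : finType) (st : store V) : nat := \sum_(v : V) nbits (st v).

Definition update (V : finType) (st : store V) (v : V) (a : nat) : store V :=
  [ffun u => if u == v then a else st u].

Definition eval (V : finType) (x : seq bool) (st : store V) (e : rhs V) : nat :=
  match e with
  | Const a => a
  | Op o y z => binop_sem o (st y) (st z)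
  | ReadAt y => nth false x (st y)
  end.

(** [exec x B p st st' out]: on input [x] and from the store [st], the program [p]
    halts with store [st'] after writing [out], and every store reached on the way
    takes at most [B] bits. *)
Inductive exec (V : finType) (x : seq bool) (B : nat) :
    cmd V -> store V -> store V -> seq bool -> Prop :=
  | ExecSkip st : exec x B Skip st st [::]
  | ExecAssign v e st :
      store_bits (update st v (eval x st e)) <= B ->
      exec x B (Assign v e) st (update st v (eval x st e)) [::]
  | ExecEmit b st : exec x B (Emit b) st st [:: b]
  | ExecSeq p q st0 st1 st2 o1 o2 :
      exec x B p st0 st1 o1 -> exec x B q st1 st2 o2 ->
      exec x B (Seq p q) st0 st2 (o1 ++ o2)
  | ExecIfTrue v p q (st st' : store V) o :
      st v != 0 -> exec x B p st st' o -> exec x B (If v p q) st st' o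
  | ExecIfFalse v p q (st st' : store V) o :
      st v = 0 -> exec x B q st st' o -> exec x B (If v p q) st st' o
  | ExecWhileStop v p (st : store V) : st v = 0 -> exec x B (While v p) st st [::]
  | ExecWhileStep v p (st0 st1 st2 : store V) o1 o2 :
      st0 v != 0 -> exec x B p st0 st1 o1 -> exec x B (While v p) st1 st2 o2 ->
      exec x B (While v p) st0 st2 (o1 ++ o2).

Definition store0 (V : finType) : store V := [ffun => 0].

Definition runs_in_space (V : finType) (p : cmd V) (x : seq bool) (B : nat)
    (out : seq bool) : Prop :=
  store_bits (store0 V) <= B /\ exists st, exec x B p (store0 V) st out.

(** The answer "NO instance" is the output [:: false]; an output instance is
    written as [true] followed by an encoding of it. *)
Definition answers_no (out : seq bool) : Prop := out = [:: false].

Definition answers_instance (out : seq bool) (J : hs_instance) : Prop :=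
  exists w, encodes w J /\ out = true :: w.

Lemma unary_inj m n (u v : seq bool) :
  unary m ++ u = unary n ++ v -> m = n /\ u = v.
Proof.
elim: m n => [|m IH] [|n] //=; first by case.
by case=> /IH[-> ->].
Qed.

Lemma row_bits_inj n : injective (@row_bits n).
Proof.
move=> S T /eq_in_map eqST; apply/setP => i.
by apply: eqST; rewrite mem_enum.
Qed.

Lemma rows_inj n (r r' : seq {set 'I_n}) (u v : seq bool) :
  flatten [seq true :: row_bits A | A <- r] ++ false :: u =
  flatten [seq true :: row_bits A | A <- r'] ++ false :: v ->
  r = r' /\ u = v.
Proof.
elim: r r' => [|S r IH] [|T r'] //=; first by case.
case=> /eqP; rewrite -!catA eqseq_cat ?size_map // => /andP[/eqP/row_bits_inj->].
by move=> /eqP/IH[-> ->].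
Qed.

Lemma encodes_inj w I J : encodes w I -> encodes w J -> I = J.
Proof.
case: I J => [n F k] [n' F' k'] [r [_ rF ->]] [r' [_ rF' /=]].
move=> /unary_inj[/= eqn]; subst n' => /rows_inj[eqr equ]; subst r'.
have [->] : k = k' /\ [::] = [::] :> seq bool.
  by apply: unary_inj; rewrite !cats0.
by move=> _; congr HSInstance; apply/setP => S; rewrite -rF -rF'.
Qed.

Lemma exec_det (V : finType) x B B' (p : cmd V) st st1 st2 o1 o2 :
  exec x B p st st1 o1 -> exec x B' p st st2 o2 -> st1 = st2 /\ o1 = o2.
Proof.
move=> e1; elim: e1 st2 o2 => {p st st1 o1};
  intros; match goal with H : exec _ B' _ _ _ _ |- _ => inversion H; subst end;
  repeat match goal with
  | H : is_true (?n != 0), H' : ?n = 0 |- _ => by rewrite H' in H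
  | IH : forall _ _, exec _ _ ?p ?st _ _ -> _, H : exec _ _ ?p ?st _ _ |- _ =>
      case: (IH _ _ H) => ? ?; subst; clear H
  end; by split.
Qed.

(* Main.v *)
Require Import Defs.
From HB Require Import structures.
From mathcomp Require Import all_boot zify.

(** Call a set [C] of at most [s] elements forced if it has more than
    [k ^ (s + 1 - |C|)] branches, where a branch of [C] is an inclusion-minimal
    superset of [C] among the forced proper supersets of [C], or a member of the
    family containing [C] with no forced set strictly in between.  If a hitting set
    [H] of size at most [k] missed [C], it would hit every branch outside [C], and
    each [h] in [H] lies in at most [k ^ (s - |C|)] of them (those are branches of
    [h |: C]); so every such [H] hits every forced set.  Hence, if the empty set is
    forced, the answer is NO; otherwise its branches form an equivalent family of at
    most [k ^ (s + 1)] sets.  In each of these it suffices to keep the elements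
    shared with another one, and the least unshared element.

    Whether [C] is forced depends on strictly larger sets only, so a recursion of
    depth [s + 1] decides it; each level needs a bounded number of registers, each
    holding an index of [O(s log n)] bits (a row of the input, or a set of at most
    [s] elements written in base [n + 1]).  The recursion is written in a language
    of arithmetic terms with bounded sums and products, whose compilation to the
    machine uses a stack of registers of height the nesting depth of the term.  The
    budget is read up to [n] only, since it may be unbounded in terms of [n]. *)

Set Implicit Arguments.
Unset Strict Implicit.
Unset Printing Implicit Defensive.

(** * Terms and their compilation *)

(** [TVar] is a de Bruijn index, [TGlob i] (with [i < 3]) is register [i], and
    [TBig p b t] is the product ([p = true]) or sum ([p = false]) of [t] over the
    values below [b] of a new variable. *)
Inductive tm :=
  | TVar of nat
  | TGlob of nat
  | TCst of nat
  | TOp of binop & tm & tm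
  | TRead of tm
  | TBig of bool & tm & tm.

Definition big_op (p : bool) : binop := if p then Mul else Add.

Fixpoint big_val (p : bool) (F : nat -> nat) (b : nat) : nat :=
  if b is b'.+1 then binop_sem (big_op p) (big_val p F b') (F b') else p.

Fixpoint teval (x : seq bool) (g e : seq nat) (t : tm) : nat :=
  match t with
  | TVar i => nth 0 e i
  | TGlob i => nth 0 g i
  | TCst a => a
  | TOp o t1 t2 => binop_sem o (teval x g e t1) (teval x g e t2)
  | TRead t1 => nth false x (teval x g e t1)
  | TBig p b t1 => big_val p (fun i => teval x g (i :: e) t1) (teval x g e b)
  end.

(** The partial results of a bounded sum or product are bounded as well, since each of them passes
    through a register. *)
Fixpoint tbounded (M : nat) (x : seq bool) (g e : seq nat) (t : tm) : Prop :=
  match t with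
  | TVar _ | TGlob _ => True
  | TCst a => a <= M
  | TOp o t1 t2 => [/\ tbounded M x g e t1, tbounded M x g e t2
                     & teval x g e (TOp o t1 t2) <= M]
  | TRead t1 => tbounded M x g e t1
  | TBig p b t1 =>
      [/\ tbounded M x g e b,
          forall i, i < teval x g e b -> tbounded M x g (i :: e) t1
        & forall i, i <= teval x g e b ->
            big_val p (fun j => teval x g (j :: e) t1) i <= M]
  end.

(** Number of consecutive registers needed by the compiled term. A second operand starts one
    register higher; the body of [TBig] starts three higher, above the accumulator, the remaining
    count and the bound variable. *)
Fixpoint tdepth (t : tm) : nat :=
  match t with
  | TVar _ | TGlob _ | TCst _ => 1
  | TOp _ t1 t2 => maxn (tdepth t1) (tdepth t2).+1
  | TRead t1 => tdepth t1
  | TBig _ b t1 => maxn (tdepth b).+1 (tdepth t1).+3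
  end.

Inductive stm :=
  | SNil
  | SEmit of tm
  | SSeq of stm & stm
  | SIf of tm & stm & stm
  | SFor of tm & stm.

Fixpoint sout (x : seq bool) (g e : seq nat) (c : stm) : seq bool :=
  match c with
  | SNil => [::]
  | SEmit t => [:: teval x g e t != 0]
  | SSeq c1 c2 => sout x g e c1 ++ sout x g e c2
  | SIf t c1 c2 => if teval x g e t != 0 then sout x g e c1 else sout x g e c2
  | SFor b c1 => flatten [seq sout x g (i :: e) c1 | i <- iota 0 (teval x g e b)]
  end.

Fixpoint sbounded (M : nat) (x : seq bool) (g e : seq nat) (c : stm) : Prop :=
  match c with
  | SNil => True
  | SEmit t => tbounded M x g e t
  | SSeq c1 c2 => sbounded M x g e c1 /\ sbounded M x g e c2
  | SIf t c1 c2 => [/\ tbounded M x g e t, sbounded M x g e c1 & sbounded M x g e c2]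
  | SFor b c1 => tbounded M x g e b /\
      forall i, i < teval x g e b -> sbounded M x g (i :: e) c1
  end.

(** A loop keeps its remaining count and its variable below its body; the third register of [SFor]
    makes room for the constant [1] even when the body is [SNil]. *)
Fixpoint sdepth (c : stm) : nat :=
  match c with
  | SNil => 0
  | SEmit t => tdepth t
  | SSeq c1 c2 => maxn (sdepth c1) (sdepth c2)
  | SIf t c1 c2 => maxn (tdepth t) (maxn (sdepth c1) (sdepth c2))
  | SFor b c1 => maxn (tdepth b) (sdepth c1).+2.+1
  end.

(** * Compilation to register programs and its correctness *)

Section Compiler.

Variable N : nat.

Local Notation reg r := (inord r : 'I_N.+1).

Definition set_const (d a : nat) : cmd 'I_N.+1 := Assign (reg d) (Const a).
Definition set_op (d : nat) (o : binop) (a b : nat) : cmd 'I_N.+1 :=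
  Assign (reg d) (Op o (reg a) (reg b)).
(** There is no copy instruction: [d] is cleared and then [a] is added to it, so [a] has to differ
    from [d]. *)
Definition set_copy (d a : nat) : cmd 'I_N.+1 := Seq (set_const d 0) (set_op d Add a d).

(** Registers at or above [d] are free; the result is left in register [d], and
    [rho] lists the registers of the bound variables. *)
Fixpoint tcomp (rho : seq nat) (d : nat) (t : tm) : cmd 'I_N.+1 :=
  match t with
  | TVar i => if i < size rho then set_copy d (nth 0 rho i) else set_const d 0
  | TGlob i => if i < 3 then set_copy d i else set_const d 0
  | TCst a => set_const d a
  | TOp o t1 t2 => Seq (tcomp rho d t1) (Seq (tcomp rho d.+1 t2) (set_op d o d d.+1))
  | TRead t1 => Seq (tcomp rho d t1) (Assign (reg d) (ReadAt (reg d)))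
  | TBig p b t1 =>
      Seq (tcomp rho d.+1 b) (Seq (set_const d p) (Seq (set_const d.+2 0)
        (While (reg d.+1)
          (Seq (tcomp (d.+2 :: rho) d.+3 t1) (Seq (set_op d (big_op p) d d.+3)
            (Seq (set_const d.+3 1) (Seq (set_op d.+2 Add d.+2 d.+3)
              (set_op d.+1 Defs.Sub d.+1 d.+3))))))))
  end.

Fixpoint scomp (rho : seq nat) (d : nat) (c : stm) : cmd 'I_N.+1 :=
  match c with
  | SNil => Skip
  | SEmit t => Seq (tcomp rho d t) (If (reg d) (Emit true) (Emit false))
  | SSeq c1 c2 => Seq (scomp rho d c1) (scomp rho d c2)
  | SIf t c1 c2 => Seq (tcomp rho d t) (If (reg d) (scomp rho d c1) (scomp rho d c2))
  | SFor b c1 =>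
      Seq (tcomp rho d b) (Seq (set_const d.+1 0)
        (While (reg d)
          (Seq (scomp (d.+1 :: rho) d.+2 c1)
            (Seq (set_const d.+2 1) (Seq (set_op d.+1 Add d.+1 d.+2)
              (set_op d Defs.Sub d d.+2))))))
  end.

Variables (x : seq bool) (B M : nat).
Hypothesis M_gt0 : 0 < M.
Hypothesis MB : N.+1 * nbits M <= B.

(** The invariant carried along executions; summed over the [N.+1] registers it yields the bit bound
    [B] through [MB]. *)
Definition bounded_store (st : store 'I_N.+1) := forall v, st v <= M.

Lemma nbits_mono a b : a <= b -> nbits a <= nbits b.
Proof. by move=> ab; rewrite /nbits ltnS leq_trunc_log. Qed.

Lemma bounded_store_bits st : bounded_store st -> store_bits st <= B.
Proof.
move=> bst; apply: leq_trans MB; rewrite /store_bits.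
rewrite -[X in _ <= X * _](card_ord N.+1) -sum_nat_const.
by apply: leq_sum => v _; apply: nbits_mono.
Qed.

Lemma bounded_update st v a : bounded_store st -> a <= M -> bounded_store (update st v a).
Proof. by move=> bst aM u; rewrite ffunE; case: ifP. Qed.

Lemma get_update (st : store 'I_N.+1) r r' a : r <= N -> r' <= N ->
  update st (reg r') a (reg r) = if r == r' then a else st (reg r).
Proof. by move=> rN rN'; rewrite ffunE -val_eqE /= !inordK. Qed.

(** A Hoare triple for total correctness with prescribed output; the lemmas that follow are its
    rules. *)
Definition runs (p : cmd 'I_N.+1) (st : store 'I_N.+1) (o : seq bool)
    (Q : store 'I_N.+1 -> Prop) : Prop :=
  exists st', [/\ exec x B p st st' o, bounded_store st' & Q st'].

Lemma runs_weaken p st o (Q Q' : store 'I_N.+1 -> Prop) :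
  runs p st o Q -> (forall st', Q st' -> Q' st') -> runs p st o Q'.
Proof. by case=> st' [ex b q] QQ'; exists st'; split=> //; apply: QQ'. Qed.

Lemma runs_seq p q st o1 o2 (Q1 Q2 : store 'I_N.+1 -> Prop) :
  runs p st o1 Q1 ->
  (forall st', bounded_store st' -> Q1 st' -> runs q st' o2 Q2) ->
  runs (Seq p q) st (o1 ++ o2) Q2.
Proof.
case=> st1 [ex1 b1 q1] /(_ st1 b1 q1)[st2 [ex2 b2 q2]].
by exists st2; split=> //; apply: ExecSeq ex1 ex2.
Qed.

Lemma runs_seq0 p q st o2 (Q1 Q2 : store 'I_N.+1 -> Prop) :
  runs p st [::] Q1 ->
  (forall st', bounded_store st' -> Q1 st' -> runs q st' o2 Q2) ->
  runs (Seq p q) st o2 Q2.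
Proof. exact: runs_seq. Qed.

Lemma runs_assign v e st (Q : store 'I_N.+1 -> Prop) :
  bounded_store st -> eval x st e <= M -> Q (update st v (eval x st e)) ->
  runs (Assign v e) st [::] Q.
Proof.
move=> bst eM q; exists (update st v (eval x st e)).
have b' := bounded_update v bst eM.
by split=> //; apply/ExecAssign/bounded_store_bits.
Qed.

Lemma runs_const d a st (Q : store 'I_N.+1 -> Prop) :
  d <= N -> bounded_store st -> a <= M ->
  (forall st' : store 'I_N.+1,
     (forall r, r <= N -> st' (reg r) = if r == d then a else st (reg r)) ->
     Q st') ->
  runs (set_const d a) st [::] Q.
Proof.
by move=> dN bst aM q; apply: runs_assign => //; apply: q => r rN; rewrite get_update.
Qed.

Lemma runs_op d o a b st (Q : store 'I_N.+1 -> Prop) :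
  d <= N -> bounded_store st -> binop_sem o (st (reg a)) (st (reg b)) <= M ->
  (forall st' : store 'I_N.+1, (forall r, r <= N -> st' (reg r) =
     if r == d then binop_sem o (st (reg a)) (st (reg b)) else st (reg r)) -> Q st') ->
  runs (set_op d o a b) st [::] Q.
Proof.
by move=> dN bst aM q; apply: runs_assign => //; apply: q => r rN; rewrite get_update.
Qed.

Lemma runs_copy d a st (Q : store 'I_N.+1 -> Prop) :
  d <= N -> a <= N -> a != d -> bounded_store st ->
  (forall st' : store 'I_N.+1, (forall r, r <= N -> st' (reg r) =
     if r == d then st (reg a) else st (reg r)) -> Q st') ->
  runs (set_copy d a) st [::] Q.
Proof.
move=> dN aN ad bst q; apply: runs_seq0.
  by apply: (@runs_const _ _ _ (fun st' => forall r, r <= N ->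
    st' (reg r) = if r == d then 0 else st (reg r))).
move=> st1 b1 q1; have e1 : st1 (reg a) = st (reg a) by rewrite q1 // (negbTE ad).
have e2 : st1 (reg d) = 0 by rewrite q1 // eqxx.
apply: runs_op => //=; rewrite e1 e2 addn0 // => st2 q2; apply: q => r rN.
by rewrite q2 //; case: ifP => // rd; rewrite q1 // rd.
Qed.

Lemma runs_if v p q (st : store 'I_N.+1) o (Q : store 'I_N.+1 -> Prop) :
  runs (if st v != 0 then p else q) st o Q -> runs (If v p q) st o Q.
Proof.
case: ifP => sv [st' [ex b qq]]; exists st'; split=> //.
  exact: ExecIfTrue.
by apply: ExecIfFalse => //; apply/eqP/negPn; rewrite sv.
Qed.

(** The loop rule: the invariant [P] is indexed by the number of completed iterations, and the
    tested register tells whether [b] of them are done. *)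
Lemma runs_countdown v p b (o : nat -> seq bool) (P : nat -> store 'I_N.+1 -> Prop) st :
  (forall i (st : store 'I_N.+1), i <= b -> P i st -> (st v != 0) = (i < b)) ->
  (forall i st, i < b -> bounded_store st -> P i st -> runs p st (o i) (P i.+1)) ->
  bounded_store st -> P 0 st ->
  runs (While v p) st (flatten [seq o i | i <- iota 0 b]) (P b).
Proof.
move=> Pv step bst P0.
(* Generalised to a loop resumed after [i] iterations with [c] to go, for induction on [c]. *)
suff H c i st0 : i + c = b -> bounded_store st0 -> P i st0 ->
    runs (While v p) st0 (flatten [seq o j | j <- iota i c]) (P b).
  exact: H P0.
elim: c i st0 => [|c IH] i st0 ic b0 Pi.
  rewrite addn0 in ic; subst i; exists st0; split=> //.
  by apply: ExecWhileStop; apply/eqP/negPn; rewrite (Pv _ _ _ Pi) // ltnn.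
have ib : i < b by lia.
have [st1 [ex1 b1 P1]] := step i st0 ib b0 Pi.
have [|st2 [ex2 b2 P2]] := IH i.+1 st1 _ b1 P1; first by lia.
exists st2; split=> //; apply: ExecWhileStep ex1 ex2.
by rewrite (Pv _ _ _ Pi) // ltnW.
Qed.

(** Globals and bound variables all live below [d], out of reach of code compiled at [d]. *)
Definition models (g : seq nat) (rho e : seq nat) (d : nat) (st : store 'I_N.+1) : Prop :=
  [/\ 3 <= d, size g = 3, forall i, i < 3 -> st (reg i) = nth 0 g i,
      size rho = size e
    & forall i, i < size rho -> nth 0 rho i < d /\ st (reg (nth 0 rho i)) = nth 0 e i].

Lemma models_eq g rho e d d' (st st' : store 'I_N.+1) :
  models g rho e d st -> d <= d' -> d <= N.+1 ->
  (forall r, r < d -> st' (reg r) = st (reg r)) ->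
  models g rho e d' st'.
Proof.
case=> d3 sg Hg srho Hrho dd' dN Hst; split=> //; first by lia.
  by move=> i i3; rewrite Hst ?Hg //; lia.
move=> i ir; have [H1 H2] := Hrho i ir; split; first by lia.
by rewrite Hst.
Qed.

Lemma models_cons g rho e d r i (st : store 'I_N.+1) :
  models g rho e d st -> r < d -> st (reg r) = i -> models g (r :: rho) (i :: e) d st.
Proof.
case=> d3 sg Hg srho Hrho rd sti; split=> //=; first by rewrite srho.
by case=> [|j] //= jr; apply: Hrho.
Qed.

Lemma tdepth_gt0 t : 0 < tdepth t.
Proof. elim: t => //= [_ t1 _ t2 _|_ t1 _ t2 _]; lia. Qed.

(** Induction on the term. That registers below [d] are left unchanged is what keeps first operands,
    loop counters and bound variables alive while subterms are evaluated. *)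
Lemma tcomp_correct g t e rho d st :
  bounded_store st -> models g rho e d st -> d + tdepth t <= N.+1 ->
  tbounded M x g e t ->
  runs (tcomp rho d t) st [::] (fun st' : store 'I_N.+1 =>
    st' (reg d) = teval x g e t /\ forall r, r < d -> st' (reg r) = st (reg r)).
Proof.
elim: t e rho d st => [i|i|a|o t1 IH1 t2 IH2|t1 IH1|p t1 IH1 t2 IH2] e rho d st bst mod /=.
- move=> dN _; case: mod => _ _ _ srho Hrho; case: ifP => ir.
    have [H1 H2] := Hrho i ir.
    apply: runs_copy => //; try lia.
    move=> st' Hst; split; first by rewrite Hst ?eqxx //; lia.
    by move=> r rd; rewrite Hst; [case: ifP => //; lia|lia].
  apply: runs_const => //; first by lia.
  move=> st' Hst; split; first by rewrite Hst ?eqxx ?nth_default //; lia.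
  by move=> r rd; rewrite Hst; [case: ifP => //; lia|lia].
- move=> dN _; case: mod => d3 sg Hg _ _; case: ifP => ir.
    apply: runs_copy => //; try lia.
    move=> st' Hst; split; first by rewrite Hst ?eqxx ?Hg //; lia.
    by move=> r rd; rewrite Hst; [case: ifP => //; lia|lia].
  apply: runs_const => //; first by lia.
  move=> st' Hst; split; first by rewrite Hst ?eqxx ?nth_default //; lia.
  by move=> r rd; rewrite Hst; [case: ifP => //; lia|lia].
- move=> dN aM; apply: runs_const => //; first by lia.
  move=> st' Hst; split; first by rewrite Hst ?eqxx //; lia.
  by move=> r rd; rewrite Hst; [case: ifP => //; lia|lia].
- move=> dN [b1 b2 bo]; have := tdepth_gt0 t2 => t2p.
  apply: runs_seq0; first by apply: (IH1 e) => //; lia.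
  move=> st1 bs1 [v1 k1]; apply: runs_seq0.
    apply: (IH2 e) => //; last by lia.
    by apply: (models_eq mod) => //; lia.
  move=> st2 bs2 [v2 k2].
  have e1 : st2 (reg d) = teval x g e t1 by rewrite k2.
  apply: runs_op; rewrite ?e1 ?v2 //; first by lia.
  move=> st3 H3; split; first by rewrite H3 ?eqxx //; lia.
  move=> r rd; rewrite H3; last by lia.
  by case: ifP => [|_]; [lia|rewrite k2 ?k1 //; lia].
- move=> dN b1; have := tdepth_gt0 t1 => t1p.
  apply: runs_seq0; first by apply: (IH1 e).
  move=> st1 bs1 [v1 k1]; apply: runs_assign => //=.
    by case: (nth _ _ _).
  split; first by rewrite get_update ?eqxx ?v1 //; lia.
  move=> r rd; rewrite get_update; try lia.
  by case: ifP => [|_]; [lia|rewrite k1].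
- move=> dN [b1 b2 bo]; have := tdepth_gt0 t1 => t1p; have := tdepth_gt0 t2 => t2p.
  apply: runs_seq0.
    apply: (IH1 e) => //; last by lia.
    by apply: (models_eq mod) => //; lia.
  move=> st1 bs1 [v1 k1].
  set bnd := teval x g e t1 in v1 bo b2 *.
  set F := (fun i => teval x g (i :: e) t2) in bo *.
  have bndM : bnd <= M by rewrite -v1.
  apply: runs_seq0.
    apply: (@runs_const _ _ _ (fun st' => forall r, r <= N ->
      st' (reg r) = if r == d then p : nat else st1 (reg r))) => //; first by lia.
    by case: (p).
  move=> st2 bs2 k2; apply: runs_seq0.
    by apply: (@runs_const _ _ _ (fun st' => forall r, r <= N ->
      st' (reg r) = if r == d.+2 then 0 else st2 (reg r))) => //; lia.
  move=> st3 bs3 k3.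
  (* Loop invariant: partial result, remaining iterations, current value of the bound variable,
     unchanged lower registers. *)
  pose P i (s : store 'I_N.+1) := [/\ s (reg d) = big_val p F i, s (reg d.+1) = bnd - i,
    s (reg d.+2) = i & forall r, r < d -> s (reg r) = st (reg r)].
  (* The loop is silent; its empty output is split into one empty piece per iteration. *)
  have -> : [::] = flatten [seq (fun _ : nat => [::] : seq bool) i | i <- iota 0 bnd].
    by elim: (iota 0 bnd).
  suff HP : runs (While (reg d.+1)
      (Seq (tcomp (d.+2 :: rho) d.+3 t2) (Seq (set_op d (big_op p) d d.+3)
       (Seq (set_const d.+3 1) (Seq (set_op d.+2 Add d.+2 d.+3)
         (set_op d.+1 Defs.Sub d.+1 d.+3)))))) st3
       (flatten [seq (fun _ : nat => [::] : seq bool) i | i <- iota 0 bnd]) (P bnd).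
    by apply: (runs_weaken HP) => st' [].
  apply: runs_countdown => //.
  + by move=> i s _ [] *; lia.
  + move=> i s ib bs [p1 p2 p3 p4].
    apply: runs_seq0.
      apply: (IH2 (i :: e)) => //; [|lia|exact: b2].
      apply: models_cons => //.
      by apply: (models_eq mod) => //; lia.
    move=> s1 bs1' [q1 q2].
    have qd : s1 (reg d) = big_val p F i by rewrite q2 ?p1 //; lia.
    apply: runs_seq0.
      apply: (@runs_op _ _ _ _ _ (fun st' => forall r, r <= N ->
        st' (reg r) = if r == d then big_val p F i.+1 else s1 (reg r))) => //; first by lia.
        by rewrite qd q1; apply: (bo i.+1).
      by move=> s' Hs' r rN; rewrite Hs' // qd q1.
    move=> s2 bs2' k2'; apply: runs_seq0.
      by apply: (@runs_const _ _ _ (fun st' => forall r, r <= N ->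
        st' (reg r) = if r == d.+3 then 1 else s2 (reg r))) => //; lia.
    move=> s3 bs3' k3'.
    have e3 : s3 (reg d.+3) = 1 by rewrite k3' ?eqxx //; lia.
    have e2 : s3 (reg d.+2) = i.
      rewrite k3' ?k2' ?q2 ?p3; try lia.
      by do 2 (case: ifP; first by lia).
    apply: runs_seq0.
      apply: (@runs_op _ _ _ _ _ (fun st' => forall r, r <= N ->
        st' (reg r) = if r == d.+2 then i.+1 else s3 (reg r))) => //; first by lia.
        by rewrite e2 e3 /=; lia.
      by move=> s' Hs' r rN; rewrite Hs' // e2 e3 /= addn1.
    move=> s4 bs4' k4'.
    have e1 : s4 (reg d.+1) = bnd - i.
      rewrite k4' ?k3' ?k2' ?q2 ?p2; try lia.
      by do 3 (case: ifP; first by lia).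
    have e4 : s4 (reg d.+3) = 1.
      by rewrite k4'; [case: ifP; [lia|rewrite e3]|lia].
    apply: runs_op => //; rewrite ?e1 ?e4 /=; try lia.
    move=> s5 k5; split.
    * rewrite k5 ?k4' ?k3' ?k2'; try lia.
      by rewrite eqxx; do 3 (case: ifP; first by lia).
    * by rewrite k5 ?eqxx; lia.
    * rewrite k5 ?k4'; try lia.
      by rewrite eqxx; case: ifP; first by lia.
    * move=> r rd; rewrite k5 ?k4' ?k3' ?k2' ?q2 ?p4; try lia.
      by do 4 (case: ifP; first by lia).
  + have get3 r : r < d -> st3 (reg r) = st (reg r).
      move=> rd; rewrite k3 ?k2 ?k1; try lia.
      by do 2 (case: ifP; first by lia).
    split=> //.
    * rewrite k3 ?k2; try lia.
      by rewrite eqxx; case: ifP; first by lia.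
    * rewrite k3 ?k2 ?v1 ?subn0; try lia.
      by do 2 (case: ifP; first by lia).
    * by rewrite k3 ?eqxx //; lia.
Qed.

Lemma scomp_correct g c e rho d st :
  bounded_store st -> models g rho e d st -> d + sdepth c <= N.+1 ->
  sbounded M x g e c ->
  runs (scomp rho d c) st (sout x g e c) (fun st' =>
    forall r, r < d -> st' (reg r) = st (reg r)).
Proof.
elim: c e rho d st => [|t|c1 IH1 c2 IH2|t c1 IH1 c2 IH2|b c1 IH1] e rho d st bst mod /=.
- by move=> _ _; exists st; split=> //; apply: ExecSkip.
- move=> dN bt; apply: runs_seq0; first exact: (tcomp_correct bst mod).
  move=> st1 bs1 [v1 k1]; apply: runs_if; rewrite v1.
  by case: ifP => _; exists st1; split=> //; apply: ExecEmit.
- move=> dN [b1 b2]; apply: runs_seq; first by apply: (IH1 e) => //; lia.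
  move=> st1 bs1 k1.
  have mod1 : models g rho e d st1 by apply: (models_eq mod) => //; lia.
  apply: (runs_weaken (IH2 e rho d st1 bs1 mod1 _ b2)); first by lia.
  by move=> st2 k2 r rd; rewrite k2 ?k1.
- move=> dN [bt b1 b2].
  apply: runs_seq0; first by apply: (tcomp_correct bst mod) => //; lia.
  move=> st1 bs1 [v1 k1]; apply: runs_if; rewrite v1.
  have mod1 : models g rho e d st1 by apply: (models_eq mod) => //; lia.
  case: ifP => _.
    apply: (runs_weaken (IH1 e rho d st1 bs1 mod1 _ b1)); first by lia.
    by move=> st2 k2 r rd; rewrite k2 ?k1.
  apply: (runs_weaken (IH2 e rho d st1 bs1 mod1 _ b2)); first by lia.
  by move=> st2 k2 r rd; rewrite k2 ?k1.
- move=> dN [bb b1].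
  apply: runs_seq0; first by apply: (tcomp_correct bst mod) => //; lia.
  move=> st1 bs1 [v1 k1].
  set bnd := teval x g e b in v1 b1 *.
  have bndM : bnd <= M by rewrite -v1.
  apply: runs_seq0.
    by apply: (@runs_const _ _ _ (fun st' => forall r, r <= N ->
      st' (reg r) = if r == d.+1 then 0 else st1 (reg r))) => //; lia.
  move=> st2 bs2 k2.
  pose P i (s : store 'I_N.+1) := [/\ s (reg d) = bnd - i, s (reg d.+1) = i
    & forall r, r < d -> s (reg r) = st (reg r)].
  suff HP : runs (While (reg d)
      (Seq (scomp (d.+1 :: rho) d.+2 c1)
       (Seq (set_const d.+2 1) (Seq (set_op d.+1 Add d.+1 d.+2)
         (set_op d Defs.Sub d d.+2))))) st2
       (flatten [seq sout x g (i :: e) c1 | i <- iota 0 bnd]) (P bnd).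
    by apply: (runs_weaken HP) => st' [].
  apply: runs_countdown => //.
  + by move=> i s _ [] *; lia.
  + move=> i s ib bs [p1 p2 p3].
    rewrite -[sout _ _ _ _]cats0; apply: runs_seq.
      apply: (IH1 (i :: e)) => //; [|lia|exact: b1].
      apply: models_cons => //.
      by apply: (models_eq mod) => //; lia.
    move=> s1 bs1' q2.
    apply: runs_seq0.
      by apply: (@runs_const _ _ _ (fun st' => forall r, r <= N ->
        st' (reg r) = if r == d.+2 then 1 else s1 (reg r))) => //; lia.
    move=> s2 bs2' k2'.
    have e2 : s2 (reg d.+2) = 1 by rewrite k2' ?eqxx //; lia.
    have e1 : s2 (reg d.+1) = i.
      rewrite k2' ?q2 ?p2; try lia.
      by case: ifP; first by lia.
    apply: runs_seq0.
      apply: (@runs_op _ _ _ _ _ (fun st' => forall r, r <= N ->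
        st' (reg r) = if r == d.+1 then i.+1 else s2 (reg r))) => //; first by lia.
        by rewrite e1 e2 /=; lia.
      by move=> s' Hs' r rN; rewrite Hs' // e1 e2 /= addn1.
    move=> s3 bs3' k3'.
    have e3 : s3 (reg d.+2) = 1.
      by rewrite k3'; [case: ifP; [lia|rewrite e2]|lia].
    have e4 : s3 (reg d) = bnd - i.
      rewrite k3' ?k2' ?q2 ?p1; try lia.
      by do 2 (case: ifP; first by lia).
    apply: runs_op => //; rewrite ?e3 ?e4 /=; try lia.
    move=> s5 k5; split.
    * by rewrite k5 ?eqxx; lia.
    * rewrite k5 ?k3'; try lia.
      by rewrite eqxx; case: ifP; first by lia.
    * move=> r rd; rewrite k5 ?k3' ?k2' ?q2 ?p3; try lia.
      by do 3 (case: ifP; first by lia).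
  + have get2 r : r <= d -> st2 (reg r) = st1 (reg r).
      by move=> rd; rewrite k2; [case: ifP; first by lia|lia].
    split=> //.
    * by rewrite get2 // v1 subn0.
    * by rewrite k2 ?eqxx //; lia.
    * by move=> r rd; rewrite get2 ?k1 //; lia.
Qed.

End Compiler.

(** * The combinatorial kernel *)

Lemma leq_card_bigcup (I T : finType) (A : {set I}) (f : I -> {set T}) :
  #|\bigcup_(i in A) f i| <= \sum_(i in A) #|f i|.
Proof.
apply: (big_ind2 (fun (X : {set T}) m => #|X| <= m)) => [|X m Y m' Xm Ym|//].
  by rewrite cards0.
exact: leq_trans (leq_card_setU _ _) (leq_add Xm Ym).
Qed.

Section Kernel.

Variables (n s k : nat) (F : {set {set 'I_n}}).

Implicit Types (C D X Y S H : {set 'I_n}) (P : pred {set 'I_n}).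

(** [P] stands for forcedness, which is defined by recursion only afterwards. A member of [F] equal
    to [C] also counts as a branch of [C]. *)
Definition branch P C X : bool :=
  [&& C \subset X, [forall D : {set 'I_n}, ~~ [&& C \proper D, D \proper X & P D]]
    & (X \in F) || (C != X) && P X].

(** The fuel makes the recursion structural. Each call concerns strictly larger sets, and sets of
    more than [s] elements are never forced, so [s.+1] levels suffice. *)
Fixpoint forced_fuel (f : nat) C : bool :=
  if f is f'.+1 then
    (#|C| <= s) && (k ^ (s.+1 - #|C|) < #|[set X | branch (forced_fuel f') C X]|)
  else false.

Definition forced := forced_fuel s.+1.

Definition branches C := [set X | branch forced C X].

Lemma eq_branch P P' C : (forall X, C \proper X -> P X = P' X) ->
  branch P C =1 branch P' C.
Proof.
move=> PP' X; rewrite /branch; case CX: (C \subset X) => //=; congr (_ && _).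
  apply: eq_forallb => D; case CD: (C \proper D) => //=.
  by rewrite PP'.
have [//|CneX] /= := eqVneq C X.
by rewrite PP' // properEneq CneX.
Qed.

(** By [eq_branch] only proper supersets of [C] are consulted, and these need at least one unit of
    fuel less. *)
Lemma forced_fuel_eq f f' C : s.+1 - #|C| <= f -> s.+1 - #|C| <= f' ->
  forced_fuel f C = forced_fuel f' C.
Proof.
elim: f f' C => [|f IH] [|f'] C H1 H2 //=; try by case: (leqP #|C| s) => //; lia.
case: (leqP #|C| s) => // Cs.
suff -> : [set X | branch (forced_fuel f) C X] = [set X | branch (forced_fuel f') C X] by [].
apply/setP => X; rewrite !inE; apply: eq_branch => Y CY; have {}CY : #|C| < #|Y| := proper_card CY.
by apply: IH; lia.
Qed.

Lemma forcedE C :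
  forced C = (#|C| <= s) && (k ^ (s.+1 - #|C|) < #|branches C|).
Proof.
rewrite /forced [LHS]/=; case: (leqP #|C| s) => //= Cs.
suff -> : [set X | branch (forced_fuel s) C X] = branches C by [].
apply/setP => X; rewrite !inE; apply: eq_branch => Y CY; have {}CY : #|C| < #|Y| := proper_card CY.
by apply: forced_fuel_eq; lia.
Qed.

Lemma forced_card C : forced C -> #|C| <= s.
Proof. by rewrite forcedE => /andP[]. Qed.

Lemma branchesP C X : reflect
  [/\ C \subset X, forall D, C \proper D -> D \proper X -> ~~ forced D
    & X \in F \/ C != X /\ forced X] (X \in branches C).
Proof.
rewrite inE; apply: (iffP and3P) => [[CX /forallP H1 H2]|[CX H1 H2]]; split=> //.
- by move=> D CD DX; have := H1 D; rewrite CD DX.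
- by case/orP: H2 => [->|/andP[]]; [left|right].
- by apply/forallP => D; apply/negP => /and3P[CD DX fD]; have := H1 D CD DX; rewrite fD.
- by case: H2 => [->//|[-> ->]]; rewrite orbT.
Qed.

Hypothesis Fmeet : forall A B, A \in F -> B \in F -> A != B -> #|A :&: B| <= s.

(** Let [C'] be [h |: C]. If [C'] is forced, minimality leaves it as the only possible branch
    through [h]. If it is unforced of size at most [s], the branches of [C] through [h] are branches
    of [C']. If it is larger, they are members of the family sharing more than [s] elements, so
    there is at most one. The [maxn 1] matters only for [k = 0]. *)
Lemma branches_through C h : h \notin C -> #|C| <= s ->
  #|[set Z in branches C | h \in Z]| <= maxn 1 (k ^ (s - #|C|)).
Proof.
move=> hC Cs; pose C' := h |: C.
have cC' : #|C'| = #|C|.+1 by rewrite cardsU1 hC.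
have CC' : C \proper C' by apply: properUr; rewrite sub1set.
have sub Z : Z \in [set Z in branches C | h \in Z] -> C' \subset Z.
  by rewrite inE => /andP[/branchesP[CZ _ _] hZ]; rewrite subUset sub1set hZ.
have [fC'|nfC'] := boolP (forced C').
  rewrite leq_max; apply/orP; left; rewrite -(cards1 C'); apply/subset_leq_card/subsetP.
  move=> Z ZG; rewrite inE eq_sym; have C'Z := sub Z ZG.
  move: ZG; rewrite inE => /andP[/branchesP[_ H _] _]; apply/negPn/negP => ne.
  by have := H C' CC'; rewrite properEneq ne C'Z fC' => /(_ isT).
rewrite leq_max; have [Cs'|Cs'] := leqP #|C'| s.
  apply/orP; right; have := nfC'; rewrite forcedE Cs' /= -leqNgt cC' subSS.
  apply: leq_trans; apply/subset_leq_card/subsetP => Z ZG; have C'Z := sub Z ZG.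
  move: ZG; rewrite inE => /andP[/branchesP[_ H1 H2] _]; apply/branchesP; split=> //.
    by move=> D C'D; apply: H1; apply: proper_trans C'D.
  case: H2 => [|[CZ fZ]]; first by left.
  by right; split=> //; apply: contraNneq nfC' => ->.
apply/orP; left; rewrite leqNgt; apply/card_gt1P => -[Z [Z' [ZG Z'G neZ]]].
have H W : W \in [set Z in branches C | h \in Z] -> W \in F.
  move=> WG; have C'W := subset_leq_card (sub W WG).
  move: WG; rewrite inE => /andP[/branchesP[_ _ [//|[_ /forced_card Ws]]] _].
  by move: (leq_trans C'W Ws); rewrite leqNgt Cs'.
have := Fmeet (H _ ZG) (H _ Z'G) neZ.
have /subset_leq_card C'ZZ' : C' \subset Z :&: Z' by rewrite subsetI !sub.
by move/(leq_trans C'ZZ'); rewrite leqNgt Cs'.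
Qed.

(** Induction from large sets to small ones: every branch of [C] is a member of [F] or a larger
    forced set, hence is hit. If [H] missed [C], covering the branches by the elements of [H]
    through them would leave too few branches for [C] to be forced. *)
Lemma forced_hit H C : #|H| <= k -> (forall S, S \in F -> H :&: S != set0) ->
  forced C -> H :&: C != set0.
Proof.
move=> Hk HF; have [m] := ubnP (n - #|C|); elim: m C => // m IH C Cm fC.
apply/eqP => HC; have := fC; rewrite forcedE => /andP[Cs]; apply/negP; rewrite -leqNgt.
have hitX X : X \in branches C -> H :&: X != set0.
  case/branchesP=> CX _ [/HF//|[CneX fX]]; apply: IH => //.
  have ltCX : #|C| < #|X| by rewrite proper_card // properEneq CneX.
  have leXn : #|X| <= n by rewrite -[X in _ <= X]card_ord max_card.
  by lia.
have -> : #|branches C| = #|\bigcup_(h in H) [set Z in branches C | h \in Z]|.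
  apply: eq_card => X; apply/idP/bigcupP => [XG|[h _]]; last by rewrite inE => /andP[].
  have /set0Pn[h /setIP[hH hX]] := hitX X XG.
  by exists h => //; rewrite inE XG.
apply: (@leq_trans (\sum_(h in H) maxn 1 (k ^ (s - #|C|)))).
  apply: leq_trans (leq_card_bigcup _ _) _; apply: leq_sum => h hH.
  apply: branches_through => //; apply/negP => hC.
  by have := in_set0 h; rewrite -HC inE hH hC.
rewrite sum_nat_const subSn // expnS.
(* A nonempty [H] makes [k] positive, which absorbs the [maxn 1]. *)
have [->|Hp] := posnP #|H|; first by rewrite mul0n.
rewrite leq_mul // geq_max leqnn andbT expn_gt0; lia.
Qed.

Definition kernel := branches set0.

(** A member of [F] outside the kernel properly contains a nonempty forced set. One of least
    cardinality is itself a branch of the empty set, and hitting it hits the member. *)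
Lemma kernel_hit H : (forall X, X \in kernel -> H :&: X != set0) ->
  forall S, S \in F -> H :&: S != set0.
Proof.
move=> HG S SF; have [SG|nSG] := boolP (S \in kernel); first exact: HG.
have [D /andP[D1 /andP[D2 fD]] Dmin] : exists2 D : {set 'I_n},
    [&& set0 \proper D, D \proper S & forced D]
    & forall D' : {set 'I_n}, [&& set0 \proper D', D' \proper S & forced D'] -> #|D| <= #|D'|.
  have [D0 HD0] : exists D : {set 'I_n}, [&& set0 \proper D, D \proper S & forced D].
    apply/existsP; move: nSG; rewrite inE /branch sub0set SF /= andbT.
    by rewrite negb_forall => /existsP[D /negPn HD]; apply/existsP; exists D.
  by case: (@arg_minnP _ D0 (fun D => [&& set0 \proper D, D \proper S & forced D])
    (fun D : {set 'I_n} => #|D|) HD0) => D HD Dm; exists D.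
have DG : D \in kernel.
  apply/branchesP; split; first exact: sub0set.
    move=> D' D'1 D'2; apply/negP => fD'.
    have := Dmin D'; rewrite D'1 fD' (proper_trans D'2 D2) => /(_ isT).
    by have := proper_card D'2; lia.
  right; split=> //; apply/eqP => D0; move: D1; by rewrite -D0 properxx.
have /set0Pn[h /setIP[hH hD]] := HG D DG.
by apply/set0Pn; exists h; rewrite inE hH (subsetP (proper_sub D2)).
Qed.

Lemma hit_kernel H : #|H| <= k -> (forall S, S \in F -> H :&: S != set0) ->
  forall X, X \in kernel -> H :&: X != set0.
Proof.
by move=> Hk HF X /branchesP[_ _ [/HF//|[_ fX]]]; apply: forced_hit.
Qed.

(** A forced set has at most [s] elements, so only two members of [F] need the hypothesis. *)
Lemma kernel_meet A B : A \in kernel -> B \in kernel -> A != B -> #|A :&: B| <= s.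
Proof.
move=> /branchesP[_ _ hA] /branchesP[_ _ hB] AB.
case: hA => [AF|[_ /forced_card As]]; last first.
  exact: leq_trans (subset_leq_card (subsetIl _ _)) As.
case: hB => [BF|[_ /forced_card Bs]]; first exact: Fmeet.
exact: leq_trans (subset_leq_card (subsetIr _ _)) Bs.
Qed.

End Kernel.

(** * Bounding the size of the sets *)

Section Trim.

Variables (n s : nat) (G : {set {set 'I_n}}).

Implicit Types (X Y H : {set 'I_n}) (e : 'I_n).

Definition degree (e : 'I_n) := #|[set X in G | e \in X]|.

(** For [X] in [G], an element of degree at most 1 is unshared, [X] itself being counted. Of these
    only the least is kept. *)
Definition trim (X : {set 'I_n}) : {set 'I_n} :=
  [set e in X | (1 < degree e) ||
                [forall e' : 'I_n, (e' < e) ==> ~~ ((e' \in X) && (degree e' <= 1))]].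

Lemma trim_sub X : trim X \subset X.
Proof. by apply/subsetP => e; rewrite inE => /andP[]. Qed.

Lemma degree_le1 e X Y : degree e <= 1 -> X \in G -> Y \in G -> e \in X -> e \in Y -> X = Y.
Proof.
move=> d1 XG YG eX eY; apply/eqP/negPn/negP => neXY; move: d1; rewrite leqNgt => /negP[].
by apply/card_gt1P; exists X, Y; rewrite !inE XG YG.
Qed.

Lemma trim_least X e : e \in X -> degree e <= 1 ->
  exists2 e' : 'I_n, e' \in trim X & degree e' <= 1.
Proof.
move=> eX d1; have He : (e \in X) && (degree e <= 1) by rewrite eX.
case: (@arg_minnP _ e (fun a => (a \in X) && (degree a <= 1))
  (fun a : 'I_n => nat_of_ord a) He) => e' /andP[eX' d1'] emin.
exists e' => //; rewrite inE eX' /= ltnNge d1' /=.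
apply/forallP => a; apply/implyP => ae; apply/negP => Ha.
by have := emin a Ha; lia.
Qed.

Lemma trim_private X a b : a \in trim X -> b \in trim X -> degree a <= 1 -> degree b <= 1 ->
  a = b.
Proof.
rewrite !inE => /andP[aX Ha] /andP[bX Hb] da db; apply: val_inj => /=.
move: Ha Hb; rewrite !ltnNge da db /= => /forallP/(_ b) Ha /forallP/(_ a) Hb.
by move: Ha Hb; rewrite aX bX da db /= !implybF => Ha Hb; lia.
Qed.

(** Shared elements survive trimming. If [X] has an unshared element, one is kept and lies in [Y]
    too, which forces [X = Y]. Hence trimmed rows are output without repetition. *)
Lemma trim_inj : {in G &, injective trim}.
Proof.
have aux X Y : X \in G -> Y \in G -> trim X = trim Y -> X \subset Y.
  move=> XG YG tXY; apply/subsetP => e eX.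
  have [d1|d2] := leqP (degree e) 1; last first.
    by apply: (subsetP (trim_sub Y)); rewrite -tXY inE eX d2.
  have [e' eX' d1'] := trim_least eX d1.
  have eY' : e' \in Y by apply: (subsetP (trim_sub Y)); rewrite -tXY.
  by rewrite -(degree_le1 d1' XG YG (subsetP (trim_sub X) _ eX') eY').
by move=> X Y XG YG tXY; apply/eqP; rewrite eqEsubset !aux.
Qed.

(** A shared [h] stays; an unshared [h] lies in at most one member, and the unshared element kept
    there replaces it. *)
Lemma trim_hit H : (forall X, X \in G -> H :&: X != set0) ->
  exists H' : {set 'I_n}, #|H'| <= #|H| /\ forall X, X \in G -> H' :&: trim X != set0.
Proof.
move=> HG.
have /fin_all_exists[f Hf] : forall h : 'I_n, exists h' : 'I_n,
    forall X, X \in G -> h \in X -> h' \in trim X.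
  move=> h; have [d1|d2] := leqP (degree h) 1; last first.
    by exists h => X XG hX; rewrite inE hX d2.
  have [/existsP[X /andP[XG hX]]|no] := boolP [exists X : {set 'I_n}, (X \in G) && (h \in X)].
    have [h' tX _] := trim_least hX d1.
    by exists h' => Y YG hY; rewrite -(degree_le1 d1 XG YG hX hY).
  by exists h => X XG hX; case/existsP: no; exists X; rewrite XG.
exists (f @: H); split; first exact: leq_imset_card.
move=> X XG; have /set0Pn[h /setIP[hH hX]] := HG X XG.
by apply/set0Pn; exists (f h); rewrite inE imset_f //= Hf.
Qed.

Hypothesis s_gt0 : 0 < s.
Hypothesis Gmeet : forall A B, A \in G -> B \in G -> A != B -> #|A :&: B| <= s.

(** All elements of [trim X] but at most one lie in [X :&: Y] for some other member [Y], at most [s]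
    for each [Y]. The exceptional one is paid for by [1 <= s]. *)
Lemma card_trim X : X \in G -> #|trim X| <= s * #|G|.
Proof.
move=> XG.
have /subset_leq_card : trim X \subset
    [set e in trim X | degree e <= 1] :|: \bigcup_(Y in G :\ X) (X :&: Y).
  apply/subsetP => e eX; rewrite inE [e \in [set _ in _ | _]]inE eX /=.
  have eX' := subsetP (trim_sub X) _ eX.
  case: leqP => //= /card_gt1P[Y [Z []]]; rewrite !inE => /andP[YG eY] /andP[ZG eZ] YZ.
  have [W WG /andP[WX eW]] : exists2 W, W \in G & (W != X) && (e \in W).
    have [YX|YX] := eqVneq Y X; last by exists Y; rewrite ?YX.
    by exists Z; rewrite // eZ -YX eq_sym YZ.
  by apply/bigcupP; exists W; rewrite !inE ?WX ?WG ?eX'.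
move=> /leq_trans; apply; apply: leq_trans (leq_card_setU _ _) _.
have le1 : #|[set e in trim X | degree e <= 1]| <= 1.
  rewrite leqNgt; apply/card_gt1P => -[a [b [/setIdP[a1 a2] /setIdP[b1 b2]]]].
  by rewrite (trim_private a1 b1 a2 b2) eqxx.
have le2 : #|\bigcup_(Y in G :\ X) (X :&: Y)| <= #|G :\ X| * s.
  rewrite -sum_nat_const; apply: leq_trans (leq_card_bigcup _ _) _.
  apply: leq_sum => Y; rewrite !inE => /andP[YX YG].
  by apply: Gmeet => //; rewrite eq_sym.
have := cardsD1 X G; rewrite XG => ->.
by apply: leq_trans (leq_add le1 le2) _; rewrite mulnDr muln1 mulnC leq_add2r.
Qed.

End Trim.

(** * Specifications of terms *)

(** Locked, so that [//] does not try to evaluate [t]. *)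
Fact tspec_key : unit. Proof. exact: tt. Qed.
Definition tspec (M : nat) (x : seq bool) (g E : seq nat) (t : tm) (v : nat) : Prop :=
  locked_with tspec_key [/\ tbounded M x g E t, teval x g E t = v & v <= M].

Lemma tspecP M x g E t v :
  tspec M x g E t v <-> [/\ tbounded M x g E t, teval x g E t = v & v <= M].
Proof. by rewrite /tspec unlock. Qed.

(** Truth values are 0 and 1: negation is truncated subtraction from 1, conjunction is the product,
    and [a <= b] is [1 - (a - b)]. *)
Definition Tnot t := TOp Defs.Sub (TCst 1) t.
Definition Tand := TOp Mul.
Definition Tor a b := Tnot (Tand (Tnot a) (Tnot b)).
Definition Timp a b := Tnot (Tand a (Tnot b)).
Definition Tle a b := Tnot (TOp Defs.Sub a b).
Definition Tlt a b := Tnot (Tle b a).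
Definition Teq a b := Tand (Tle a b) (Tle b a).
Definition Tall := TBig true.
Definition Tex b t := Tnot (Tall b (Tnot t)).
Definition Tcount := TBig false.
(** [a] is evaluated under the binder of the product, so it must be free of [TVar]. *)
Definition Tpow a b := TBig true b a.

Lemma iota_rcons i : iota 0 i.+1 = rcons (iota 0 i) i.
Proof. by rewrite -addn1 iotaD cats1. Qed.

Lemma leq_pow2 a b i : a <= b -> a ^ i <= b ^ i.
Proof. by case: i => // i ab; rewrite leq_exp2r. Qed.

Section Specs.

Variables (M : nat) (x : seq bool) (g : seq nat).
Hypothesis M_gt0 : 0 < M.

Local Notation spec := (tspec M x g).

Let le_boolM (b : bool) : b <= M.
Proof. by case: b. Qed.

Lemma spec_var E i v : nth 0 E i = v -> v <= M -> spec E (TVar i) v.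
Proof. by move=> <- vM; apply/tspecP. Qed.

Lemma spec_glob E i v : nth 0 g i = v -> v <= M -> spec E (TGlob i) v.
Proof. by move=> <- vM; apply/tspecP. Qed.

Lemma spec_cst E a : a <= M -> spec E (TCst a) a.
Proof. by move=> aM; apply/tspecP. Qed.

Lemma spec_op o E t1 t2 v1 v2 : spec E t1 v1 -> spec E t2 v2 ->
  binop_sem o v1 v2 <= M -> spec E (TOp o t1 t2) (binop_sem o v1 v2).
Proof.
move=> /tspecP[b1 e1 l1] /tspecP[b2 e2 l2] le; apply/tspecP.
by split=> //=; rewrite e1 e2.
Qed.

Lemma spec_add E t1 t2 v1 v2 : spec E t1 v1 -> spec E t2 v2 ->
  v1 + v2 <= M -> spec E (TOp Add t1 t2) (v1 + v2).
Proof. exact: (@spec_op Add). Qed.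

Lemma spec_mul E t1 t2 v1 v2 : spec E t1 v1 -> spec E t2 v2 ->
  v1 * v2 <= M -> spec E (TOp Mul t1 t2) (v1 * v2).
Proof. exact: (@spec_op Mul). Qed.

(** Differences, quotients and remainders never exceed their first operand, so they need no bound of
    their own. *)
Lemma spec_sub E t1 t2 v1 v2 : spec E t1 v1 -> spec E t2 v2 ->
  spec E (TOp Defs.Sub t1 t2) (v1 - v2).
Proof.
move=> s1 s2; apply: (@spec_op Defs.Sub) => //=.
by apply: leq_trans (leq_subr _ _) _; case/tspecP: s1.
Qed.

Lemma spec_div E t1 t2 v1 v2 : spec E t1 v1 -> spec E t2 v2 ->
  spec E (TOp Div t1 t2) (v1 %/ v2).
Proof.
move=> s1 s2; apply: (@spec_op Div) => //=.
by apply: leq_trans (leq_div _ _) _; case/tspecP: s1.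
Qed.

Lemma spec_mod E t1 t2 v1 v2 : spec E t1 v1 -> spec E t2 v2 ->
  spec E (TOp Mod t1 t2) (v1 %% v2).
Proof.
move=> s1 s2; apply: (@spec_op Mod) => //=.
by apply: leq_trans (leq_mod _ _) _; case/tspecP: s1.
Qed.

Lemma spec_read E t v : spec E t v -> spec E (TRead t) (nth false x v).
Proof. by move=> /tspecP[b1 e1 l1]; apply/tspecP; split=> //=; rewrite e1. Qed.

Lemma spec_eq E t v v' : v = v' -> spec E t v -> spec E t v'.
Proof. by move=> ->. Qed.

Lemma spec_not E t (b : bool) : spec E t b -> spec E (Tnot t) (~~ b).
Proof.
move=> sb; apply: (@spec_eq _ _ (1 - b)); first by case: b {sb}.
by apply: spec_sub => //; apply: spec_cst.
Qed.

Lemma spec_and E t1 t2 (b1 b2 : bool) : spec E t1 b1 -> spec E t2 b2 ->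
  spec E (Tand t1 t2) (b1 && b2).
Proof.
move=> s1 s2; apply: (@spec_eq _ _ (b1 * b2)); first by case: b1 b2 {s1 s2} => [] [].
by apply: spec_mul => //; rewrite mulnb.
Qed.

Lemma spec_or E t1 t2 (b1 b2 : bool) : spec E t1 b1 -> spec E t2 b2 ->
  spec E (Tor t1 t2) (b1 || b2).
Proof.
move=> s1 s2; rewrite -[b1 || b2]negbK negb_or.
by apply/spec_not/spec_and; apply: spec_not.
Qed.

Lemma spec_imp E t1 t2 (b1 b2 : bool) : spec E t1 b1 -> spec E t2 b2 ->
  spec E (Timp t1 t2) (b1 ==> b2).
Proof.
move=> s1 s2; rewrite -[b1 ==> b2]negbK negb_imply.
by apply/spec_not/spec_and => //; apply: spec_not.
Qed.

Lemma spec_le E t1 t2 v1 v2 : spec E t1 v1 -> spec E t2 v2 -> spec E (Tle t1 t2) (v1 <= v2).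
Proof.
move=> s1 s2; apply: (@spec_eq _ _ (1 - (v1 - v2))); first by lia.
by apply: spec_sub; [apply: spec_cst|apply: spec_sub].
Qed.

Lemma spec_lt E t1 t2 v1 v2 : spec E t1 v1 -> spec E t2 v2 -> spec E (Tlt t1 t2) (v1 < v2).
Proof. by move=> s1 s2; rewrite ltnNge; apply/spec_not/spec_le. Qed.

Lemma spec_eqn E t1 t2 v1 v2 : spec E t1 v1 -> spec E t2 v2 -> spec E (Teq t1 t2) (v1 == v2).
Proof. by move=> s1 s2; rewrite eqn_leq; apply: spec_and; apply: spec_le. Qed.

Lemma spec_big p E tb t b F : spec E tb b ->
  (forall i, i < b -> spec (i :: E) t (F i)) ->
  (forall i, i <= b -> big_val p F i <= M) ->
  spec E (TBig p tb t) (big_val p F b).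
Proof.
move=> /tspecP[b1 e1 l1] sF lF.
have eqF i : i <= b -> big_val p (fun j => teval x g (j :: E) t) i = big_val p F i.
  elim: i => //= i IH ib; rewrite IH; last exact: ltnW.
  by have /tspecP[_ -> _] := sF i ib.
apply/tspecP; split=> /=; rewrite ?e1; [split; rewrite ?e1 // | exact: eqF | exact: lF].
- by move=> i /sF/tspecP[].
- by move=> i ib; rewrite eqF ?lF.
Qed.

Lemma spec_all E tb t b (P : pred nat) : spec E tb b ->
  (forall i, i < b -> spec (i :: E) t (P i)) -> spec E (Tall tb t) (all P (iota 0 b)).
Proof.
move=> sb sP.
have eqA i : big_val true P i = all P (iota 0 i).
  by elim: i => [//|i IH]; rewrite iota_rcons all_rcons andbC -mulnb -IH.
rewrite -eqA; apply: spec_big => // i _; rewrite eqA; exact: le_boolM.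
Qed.

Lemma spec_ex E tb t b (P : pred nat) : spec E tb b ->
  (forall i, i < b -> spec (i :: E) t (P i)) -> spec E (Tex tb t) (has P (iota 0 b)).
Proof.
move=> sb sP; rewrite -[has _ _]negbK -all_predC; apply/spec_not/spec_all => // i ib.
exact/spec_not/sP.
Qed.

Lemma spec_count E tb t b (P : pred nat) : spec E tb b ->
  (forall i, i < b -> spec (i :: E) t (P i)) -> spec E (Tcount tb t) (count P (iota 0 b)).
Proof.
move=> sb sP.
have eqC i : big_val false P i = count P (iota 0 i).
  elim: i => [//|i IH]; rewrite iota_rcons -cats1 count_cat -IH /= addn0.
  by [].
rewrite -eqC; apply: spec_big => // i ib; rewrite eqC.
apply: leq_trans (count_size _ _) _; rewrite size_iota.
by case/tspecP: sb => _ _; apply: leq_trans.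
Qed.

(** Intermediate powers are compared with those of the positive base [d.+1], because powers of [v]
    need not increase with the exponent when [v = 0]. *)
Lemma spec_pow E a b v w d : (forall i, spec (i :: E) a v) -> spec E b w ->
  v <= d.+1 -> d.+1 ^ w <= M -> spec E (Tpow a b) (v ^ w).
Proof.
move=> sa sb vd dM.
have eqP i : big_val true (fun=> v) i = v ^ i.
  by elim: i => //= i ->; rewrite expnSr.
rewrite -eqP; apply: spec_big => // i ib; rewrite eqP.
apply: leq_trans dM; apply: (@leq_trans (d.+1 ^ i)); first exact: leq_pow2.
by rewrite leq_pexp2l.
Qed.

End Specs.

(** * The program and its output *)

Section Codes.

Variable n : nat.

Definition digit (a i : nat) := (a %/ n.+1 ^ i) %% n.+1.

(** The digit [0] is a blank, and [e.+1] stands for the element [e]. *)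
Definition decode (t a : nat) : {set 'I_n} :=
  [set e : 'I_n | has (fun i => digit a i == e.+1) (iota 0 t)].

Fixpoint code (l : seq nat) : nat := if l is e :: l' then code l' * n.+1 + e.+1 else 0.

Lemma code_lt l : all (gtn n) l -> code l < n.+1 ^ size l.
Proof.
elim: l => //= e l IH /andP[en /IH lt]; rewrite expnSr.
by apply: (@leq_trans ((code l).+1 * n.+1)); [rewrite mulSn; lia|rewrite leq_mul2r lt orbT].
Qed.

Lemma digit_code l i : all (gtn n) l -> digit (code l) i = nth 0 (map succn l) i.
Proof.
elim: l i => [|e l IH] i; first by rewrite /digit div0n mod0n nth_nil.
case/andP=> en ln; case: i => [|i] /=; first by rewrite /digit expn0 divn1 modnMDl modn_small.
by rewrite -IH // /digit expnS divnMA divnMDl // (@divn_small e.+1) ?addn0.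
Qed.

(** The elements are listed as digits and the remaining positions are blank, so sets of fewer than
    [t] elements are reached too. *)
Lemma decode_surj t (D : {set 'I_n}) : #|D| <= t -> exists2 a, a < n.+1 ^ t & decode t a = D.
Proof.
move=> Dt; pose l := [seq nat_of_ord e | e <- enum D].
have ln : all (gtn n) l by apply/allP => _ /mapP[e _ ->] /=.
have sl : size l <= t by rewrite size_map -cardE.
exists (code l).
  by apply: leq_trans (code_lt ln) _; rewrite leq_pexp2l.
apply/setP => e; rewrite inE; apply/hasP/idP => [[i _]|eD].
  rewrite digit_code // => /eqP ei.
  have il : i < size l.
    rewrite ltnNge; apply/negP => li; move: ei; rewrite nth_default // size_map.
    by [].
  move: ei; rewrite (nth_map 0) // => -[] ei.
  have : nat_of_ord e \in l by rewrite -ei mem_nth.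
  by rewrite mem_map ?mem_enum //; apply: ord_inj.
have el : nat_of_ord e \in l by rewrite mem_map ?mem_enum //; apply: ord_inj.
exists (index (nat_of_ord e) l).
  by rewrite mem_iota /= add0n; apply: leq_trans sl; rewrite index_mem.
by rewrite digit_code // (nth_map 0) ?index_mem // nth_index.
Qed.

Lemma card_small_sets t : #|[set D : {set 'I_n} | #|D| <= t]| <= n.+1 ^ t.
Proof.
rewrite -[X in _ <= X]card_ord -cardsT.
apply: leq_trans (leq_imset_card (fun a : 'I_(n.+1 ^ t) => decode t a) _).
apply/subset_leq_card/subsetP => D; rewrite inE => /decode_surj[a at_ <-].
by apply/imsetP; exists (Ordinal at_).
Qed.

(** Cutting each member to its first [s.+1] elements is injective: a common cut lies in the
    intersection, so it has at most [s] elements, and both members equal their cut. Thus row indices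
    need only [O(s log n)] bits. *)
Lemma card_meet_family s (F : {set {set 'I_n}}) :
  (forall A B, A \in F -> B \in F -> A != B -> #|A :&: B| <= s) -> #|F| <= n.+1 ^ s.+1.
Proof.
move=> Fm; pose h (X : {set 'I_n}) : {set 'I_n} := [set e in take s.+1 (enum X)].
have card_h X : #|h X| = minn s.+1 #|X|.
  rewrite cardsE (card_uniqP _) ?take_uniq ?enum_uniq // size_take_min -cardE.
  by [].
have hX X : h X \subset X.
  by apply/subsetP => e; rewrite inE => /mem_take; rewrite mem_enum.
have h_inj : {in F &, injective h}.
  move=> X Y XF YF hXY; apply/eqP/negPn/negP => neXY.
  have hm : h X \subset X :&: Y by rewrite subsetI hX hXY hX.
  have := leq_trans (subset_leq_card hm) (Fm X Y XF YF neXY).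
  rewrite card_h => le; have Xs : #|X| <= s by lia.
  have Ys : #|Y| <= s by have := card_h Y; rewrite -hXY card_h; lia.
  have full (Z : {set 'I_n}) : #|Z| <= s -> h Z = Z.
    by move=> Zs; apply/eqP; rewrite eqEcard hX card_h; lia.
  by move: neXY; rewrite -(full X Xs) hXY full ?eqxx.
rewrite -(card_in_imset h_inj); apply: leq_trans (card_small_sets s.+1).
apply/subset_leq_card/subsetP => _ /imsetP[X _ ->]; rewrite inE card_h.
exact: geq_minl.
Qed.

End Codes.

Definition sspec (M : nat) (x : seq bool) (g E : seq nat) (c : stm) (o : seq bool) : Prop :=
  locked_with tspec_key (sbounded M x g E c /\ sout x g E c = o).

Lemma sspecP M x g E c o :
  sspec M x g E c o <-> sbounded M x g E c /\ sout x g E c = o.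
Proof. by rewrite /sspec unlock. Qed.

Section StmSpecs.

Variables (M : nat) (x : seq bool) (g : seq nat).

Lemma sspec_emit E t (b : bool) : tspec M x g E t b -> sspec M x g E (SEmit t) [:: b].
Proof. by case/tspecP=> bt et _; apply/sspecP; split=> //=; rewrite et; case: b {et}. Qed.

Lemma sspec_seq E c1 c2 o1 o2 : sspec M x g E c1 o1 -> sspec M x g E c2 o2 ->
  sspec M x g E (SSeq c1 c2) (o1 ++ o2).
Proof. by move=> /sspecP[b1 e1] /sspecP[b2 e2]; apply/sspecP; split=> //=; rewrite e1 e2. Qed.

Lemma sspec_if E t c1 c2 (b : bool) o1 o2 : tspec M x g E t b ->
  sspec M x g E c1 o1 -> sspec M x g E c2 o2 ->
  sspec M x g E (SIf t c1 c2) (if b then o1 else o2).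
Proof. 
move=> /tspecP[bt et _] /sspecP[b1 e1] /sspecP[b2 e2]; apply/sspecP.
by split=> //=; rewrite et e1 e2; case: b {et}.
 Qed.

Lemma sspec_for E tb c b o : tspec M x g E tb b ->
  (forall i, i < b -> sspec M x g (i :: E) c (o i)) ->
  sspec M x g E (SFor tb c) (flatten [seq o i | i <- iota 0 b]).
Proof.
move=> /tspecP[bt et _] H; apply/sspecP; split=> /=; rewrite et.
  by split=> // i /H/sspecP[].
congr flatten; apply/eq_in_map => i; rewrite mem_iota => /= ib.
by have /sspecP[] := H i ib.
Qed.

End StmSpecs.

Lemma flatten_nseq b : flatten [seq [:: true] | i <- iota 0 b] = nseq b true.
Proof. by elim: b 0 => //= b IH j; rewrite IH. Qed.

Lemma flatten_if (T U : Type) (p : pred T) (f : T -> seq U) l :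
  flatten [seq if p a then f a else [::] | a <- l] = flatten [seq f a | a <- l & p a].
Proof. by elim: l => //= a l ->; case: ifP. Qed.

Lemma row_bitsE n (S : {set 'I_n}) :
  row_bits S = flatten [seq [:: if insub i is Some e then (e : 'I_n) \in S else false]
                       | i <- iota 0 n].
Proof.
rewrite -val_enum_ord -map_comp flatten_map1 /row_bits.
by apply: eq_map => i /=; rewrite valK.
Qed.

Lemma all_iota_ord b (P : pred nat) : all P (iota 0 b) = [forall i : 'I_b, P i].
Proof.
apply/allP/forallP => [H i|H i]; first by apply: H; rewrite mem_iota ltn_ord.
by rewrite mem_iota => /= ib; apply: (H (Ordinal ib)).
Qed.

Lemma count_iota_ord b (P : pred nat) : count P (iota 0 b) = #|[set i : 'I_b | P i]|.
Proof.
rewrite -val_enum_ord count_map cardsE cardE size_filter enumT.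
by apply: eq_count.
Qed.

Lemma ltn_of_leq_sub1 a d : 0 < d -> a <= d - 1 -> a < d.
Proof. by lia. Qed.

(** * Terms for forcedness, the kernel and trimming *)

Section Program.

Variable s : nat.

(** The globals are the universe size, the number of rows and the budget capped at the universe
    size. *)
Definition Tn := TGlob 0.
Definition Tm := TGlob 1.
Definition Tk := TGlob 2.
Definition Tn1 := TOp Add Tn (TCst 1).
Definition TQ := Tpow Tn1 (TCst s).
Definition TA := TOp Add TQ Tm.

(** A code is searched digit by digit. Row [i] occupies [n.+1] bits from address [i.+1 * n.+1] on,
    its marker first, whence the shift by 1 for the element. *)
Definition Tmem a e :=
  Tor (Tand (Tlt (TVar a) TQ)
        (Tex (TCst s) (Teq (TOp Mod (TOp Div (TVar a.+1) (Tpow Tn1 (TVar 0))) Tn1)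
                           (TOp Add (TVar e.+1) (TCst 1)))))
      (Tand (Tle TQ (TVar a))
        (TRead (TOp Add (TOp Mul (TOp Add (TOp Defs.Sub (TVar a) TQ) (TCst 1)) Tn1)
                        (TOp Add (TVar e) (TCst 1))))).

Definition Tsub a b := Tall Tn (Timp (Tmem a.+1 0) (Tmem b.+1 0)).
Definition Tproper a b := Tand (Tsub a b) (Tnot (Tsub b a)).
Definition Tsize a := Tcount Tn (Tmem a.+1 0).
(** A set may have several indices; keeping only the last makes counting indices count sets. *)
Definition Tfresh a :=
  Tall TA (Tnot (Tand (Tlt (TVar a.+1) (TVar 0)) (Tand (Tsub a.+1 0) (Tsub 0 a.+1)))).

Definition Tbranch (P : nat -> tm) c a :=
  Tand (Tfresh a) (Tand (Tsub c a)
    (Tand (Tall TA (Tnot (Tand (Tproper c.+1 0) (Tand (Tproper 0 a.+1) (P 0)))))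
          (Tor (Tle TQ (TVar a)) (Tand (Tnot (Tsub a c)) (P a))))).

(** The recursion is unrolled into a term that depends on [s] and [f] only, not on the input. *)
Fixpoint Tforced f c :=
  if f is f'.+1 then
    Tand (Tle (Tsize c) (TCst s))
         (Tlt (Tpow Tk (TOp Defs.Sub (TCst s.+1) (Tsize c)))
              (Tcount TA (Tbranch (Tforced f') c.+1 0)))
  else TCst 0.

Definition Tkernel := Tbranch (Tforced s.+1).
Definition Tdeg c e := Tcount TA (Tand (Tkernel c.+1 0) (Tmem 0 e.+1)).
Definition Tkeep c a e :=
  Tand (Tmem a e)
    (Tor (Tlt (TCst 1) (Tdeg c e))
         (Tall (TVar e) (Tnot (Tand (Tmem a.+1 0) (Tle (Tdeg c.+1 0) (TCst 1)))))).

(** The outer loop over [0] binds a variable to the index [0] of the empty set. *)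
Definition Smain :=
  SFor (TCst 1)
    (SIf (Tforced s.+1 0) (SEmit (TCst 0))
      (SSeq (SEmit (TCst 1))
      (SSeq (SFor Tn (SEmit (TCst 1)))
      (SSeq (SEmit (TCst 0))
      (SSeq (SFor TA (SIf (Tkernel 1 0)
              (SSeq (SEmit (TCst 1)) (SFor Tn (SEmit (Tkeep 2 1 0)))) SNil))
      (SSeq (SEmit (TCst 0))
      (SSeq (SFor Tk (SEmit (TCst 1)))
            (SEmit (TCst 0))))))))).

(** Counts the [i] for which the markers of rows [0] to [i] are all set; [count_prefix] shows that
    this is the number of rows. *)
Definition Trows :=
  Tcount (Tpow Tn1 (TCst s.+1))
    (Tall (TOp Add (TVar 0) (TCst 1)) (TRead (TOp Mul (TOp Add (TVar 0) (TCst 1)) Tn1))).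

(** The same prefix count in the unary tail that follows the end marker, cut off at [n]. *)
Definition Tbudget :=
  Tcount Tn
    (Tall (TOp Add (TVar 0) (TCst 1))
      (TRead (TOp Add (TVar 0)
        (TOp Add (TOp Mul (TOp Add Tm (TCst 1)) Tn1) (TCst 1))))).

Local Ltac solve_tdepth :=
  rewrite /=;
  repeat match goal with
  | |- is_true (maxn _ _ <= _) => rewrite geq_max; apply/andP; split
  | |- is_true ((_).+1 <= _) => apply: ltn_of_leq_sub1; [lia|]
  end; lia.

(** * Register depth linear in [s] *)

Lemma tdepth_branch P c a d : 40 <= d -> (forall c, tdepth (P c) <= d) ->
  tdepth (Tbranch P c a) <= d + 9.
Proof.
move=> d40 Pd.
have [P0 Pa] := (Pd 0, Pd a).
have dfresh : tdepth (Tfresh a) = 29 by [].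
have dsub b b' : tdepth (Tsub b b') = 23 by [].
have dproper b b' : tdepth (Tproper b b') = 25 by [].
have dA : tdepth TA = 5 by [].
have dQ : tdepth (Tle TQ (TVar a)) = 6 by [].
rewrite /Tbranch; move: dfresh (dsub c a) (dsub a c) (dproper c.+1 0) (dproper 0 a.+1) dA dQ.
move: P0 Pa; move: (Tle TQ _) => q; move: (Tfresh a) (Tsub c a) (Tsub a c).
move: (Tproper c.+1 0) (Tproper 0 a.+1) TA (P 0) (P a) => *.
solve_tdepth.
Qed.

Lemma tdepth_forced f c : tdepth (Tforced f c) <= 40 * f.+1.
Proof.
elim: f c => [|f IH] c //.
have dA : tdepth TA = 5 by [].
have Hb : tdepth (Tbranch (Tforced f) c.+1 0) <= 40 * f.+1 + 9 by apply: tdepth_branch => //; lia.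
have dsize : tdepth (Tle (Tsize c) (TCst s)) = 21 by [].
have dpow : tdepth (Tpow Tk (TOp Defs.Sub (TCst s.+1) (Tsize c))) = 22 by [].
rewrite [Tforced _ _]/=; move: dA Hb dsize dpow.
move: TA (Tbranch _ _ _) (Tle _ _) (Tpow _ _) => *.
solve_tdepth.
Qed.

Lemma tdepth_kernel c a : tdepth (Tkernel c a) <= 40 * s + 89.
Proof.
apply: leq_trans (tdepth_branch c a (d := 40 * s.+2) _ (tdepth_forced s.+1)) _; lia.
Qed.

Lemma tdepth_deg c e : tdepth (Tdeg c e) <= 40 * s + 92.
Proof.
have dA : tdepth TA = 5 by [].
have dm : tdepth (Tmem 0 e.+1) = 17 by [].
have dk := tdepth_kernel c.+1 0.
rewrite /Tdeg; move: dA dm dk; move: (Tkernel c.+1 0) TA (Tmem 0 e.+1) => *.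
solve_tdepth.
Qed.

Lemma tdepth_keep c a e : tdepth (Tkeep c a e) <= 40 * s + 110.
Proof.
have dm b b' : tdepth (Tmem b b') = 17 by [].
have [d0 d1] := (tdepth_deg c e, tdepth_deg c.+1 0).
rewrite /Tkeep; move: (dm a e) (dm a.+1 0) d0 d1.
move: (Tdeg c e) (Tdeg c.+1 0) (Tmem a e) (Tmem a.+1 0) => *.
solve_tdepth.
Qed.

Lemma sdepth_main : sdepth Smain <= 40 * s + 130.
Proof.
have [[dk dp] df] := (tdepth_kernel 1 0, tdepth_keep 2 1 0, tdepth_forced s.+1 0).
move: dk dp df; rewrite /Smain; move: (Tkernel 1 0) (Tkeep 2 1 0) (Tforced s.+1 0) => a b c.
have dA : tdepth TA = 5 by [].
move: TA dA => A dA Ha Hb Hc; solve_tdepth.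
Qed.

Lemma tdepth_rows : tdepth Trows <= 20. Proof. by []. Qed.

Lemma tdepth_budget : tdepth Tbudget <= 20. Proof. by []. Qed.

(** * Indices and the sets they denote *)

Variables (n m k M : nat) (x : seq bool) (r : seq {set 'I_n}).
Local Notation g := [:: n; m; k].
Local Notation Q := (n.+1 ^ s).
Local Notation A := (Q + m).
Local Notation spec := (tspec M x g).
Local Notation F := [set S in r].
Local Notation K := (kernel s k F).

Hypothesis r_size : size r = m.

(** Indices below [Q] are codes of sets of at most [s] elements, the others are rows.
    [fresh] selects the last index of each set, so that a fresh index is a row as soon
    as its set is in the family. *)
Definition set_at (a : nat) : {set 'I_n} := if a < Q then decode n s a else nth set0 r (a - Q).
Definition fresh (a : nat) := all (fun b => ~~ ((a < b) && (set_at a == set_at b))) (iota 0 A).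

(** If the set of a fresh code were also a row, the index of that row would be a later one. *)
Lemma set_at_row a : fresh a -> a < A -> (Q <= a) = (set_at a \in F).
Proof.
move=> fa aA; apply/idP/idP => [Qa|].
  by rewrite inE /set_at ltnNge Qa /= mem_nth // r_size; lia.
rewrite inE => aF; rewrite leqNgt; apply/negP => aQ.
have /allP/(_ (Q + index (set_at a) r)) := fa.
have im : index (set_at a) r < m by rewrite -r_size index_mem.
rewrite mem_iota /= ltn_add2l im => /(_ isT); rewrite negb_and.
have -> : a < Q + index (set_at a) r by lia.
rewrite /= {2}/set_at ltnNge leq_addr /= addKn nth_index //.
by rewrite eqxx.
Qed.

Lemma fresh_inj a b : fresh a -> fresh b -> a < A -> b < A -> set_at a = set_at b -> a = b.
Proof.
move=> /allP fa /allP fb aA bA eab.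
have := fa b; rewrite mem_iota /= bA eab eqxx andbT => /(_ isT).
have := fb a; rewrite mem_iota /= aA eab eqxx andbT => /(_ isT).
by lia.
Qed.

Lemma fresh_exists X : X \in F \/ #|X| <= s -> exists a, [/\ a < A, fresh a & set_at a = X].
Proof.
move=> hX.
have ex : exists a : 'I_A, set_at a == X.
  case: hX => [|Xs].
    rewrite inE => Xr; have im : Q + index X r < A by rewrite ltn_add2l -r_size index_mem.
    by exists (Ordinal im); rewrite /= /set_at ltnNge leq_addr /= addKn nth_index.
  have [a aQ aX] := decode_surj Xs; have aA : a < A by lia.
  by exists (Ordinal aA); rewrite /= /set_at aQ aX.
case: ex => a0 Ha0.
case: (@arg_maxnP _ a0 (fun a : 'I_A => set_at a == X) (fun a : 'I_A => nat_of_ord a) Ha0).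
move=> a /eqP aX amax; exists a; split=> //.
apply/allP => b; rewrite mem_iota /= => bA; apply/negP => /andP[ab /eqP eab].
by have := amax (Ordinal bA); rewrite /= -eab aX eqxx => /(_ isT); lia.
Qed.

Definition fresh_list (p : pred {set 'I_n}) :=
  [seq a <- iota 0 A | fresh a && p (set_at a)].

Lemma fresh_list_uniq p : uniq [seq set_at a | a <- fresh_list p].
Proof.
rewrite map_inj_in_uniq ?filter_uniq ?iota_uniq // => a b.
rewrite !mem_filter !mem_iota /= => /andP[/andP[fa _] aA] /andP[/andP[fb _] bA].
exact: fresh_inj.
Qed.

Lemma mem_fresh_list (p : pred {set 'I_n}) X : (p X -> X \in F \/ #|X| <= s) ->
  (X \in [seq set_at a | a <- fresh_list p]) = p X.
Proof.
move=> pX; apply/mapP/idP => [[a]|Xp].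
  by rewrite mem_filter => /andP[/andP[_ pa] _] ->.
have [a [aA fa ea]] := fresh_exists (pX Xp).
by exists a => //; rewrite mem_filter fa ea Xp mem_iota.
Qed.

(** Links what the program counts, indices, to what the kernel speaks of, sets. *)
Lemma count_fresh (p : pred {set 'I_n}) : (forall X, p X -> X \in F \/ #|X| <= s) ->
  count (fun a => fresh a && p (set_at a)) (iota 0 A) = #|[set X | p X]|.
Proof.
move=> pX; rewrite -size_filter -(size_map set_at).
rewrite -(card_uniqP (fresh_list_uniq p)); apply: eq_card => X.
by rewrite inE mem_fresh_list //; apply: pX.
Qed.

Lemma branch_small (p : pred {set 'I_n}) C X : (forall X, p X -> #|X| <= s) -> branch F p C X ->
  X \in F \/ #|X| <= s.
Proof.
by move=> ps /and3P[_ _ /orP[->|/andP[_ /ps Xs]]]; [left|right].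
Qed.

Lemma forced_fuel_card f X : forced_fuel s k F f X -> #|X| <= s.
Proof. by case: f => //= f /andP[]. Qed.

Lemma kernel_small X : X \in K -> X \in F \/ #|X| <= s.
Proof. by rewrite inE; apply: branch_small; apply: forced_fuel_card. Qed.

Lemma set_at0 : set_at 0 = set0.
Proof.
rewrite /set_at expn_gt0 /=; apply/setP => e; rewrite !inE.
by apply/hasP => -[i _]; rewrite /digit div0n mod0n.
Qed.

(** * Correctness of the terms *)

Hypothesis row_x : forall i (e : 'I_n), i < m ->
  nth false x (i.+1 * n.+1 + e.+1) = (e \in nth set0 r i).
Hypothesis kn : k <= n.
Hypothesis sM : s.+1 <= M.
Hypothesis QM : n.+1 ^ s.+1 <= M.
Hypothesis AM : A.+1 * n.+1 + n.+1 <= M.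

Let M_gt0 : 0 < M. Proof. exact: leq_trans sM. Qed.
Let nM : n.+1 <= M. Proof. by apply: leq_trans AM; rewrite leq_addl. Qed.
Let AM' : A <= M.
Proof. by apply: leq_trans AM; rewrite mulnS; lia. Qed.

Lemma spec_n E : spec E Tn n.
Proof. by apply: spec_glob => //; lia. Qed.

Lemma spec_m E : spec E Tm m.
Proof. by apply: spec_glob => //; lia. Qed.

Lemma spec_k E : spec E Tk k.
Proof. by apply: spec_glob => //; lia. Qed.

Lemma spec_n1 E : spec E Tn1 n.+1.
Proof.
by rewrite -addn1; apply: spec_add; [apply: spec_n|apply: spec_cst|rewrite addn1].
Qed.

Lemma spec_Q E : spec E TQ Q.
Proof.
apply: (@spec_pow _ _ _ _ _ _ _ _ n) => //; last by lia.
  by move=> i; apply: spec_n1.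
by apply: spec_cst; lia.
Qed.

Lemma spec_A E : spec E TA A.
Proof. by apply: spec_add => //; [apply: spec_Q|apply: spec_m]. Qed.

Lemma spec_mem E a e : nth 0 E a < A -> forall en : nth 0 E e < n,
  spec E (Tmem a e) (Ordinal en \in set_at (nth 0 E a)).
Proof.
move=> aA en; set va := nth 0 E a in aA *; set ve := nth 0 E e in en *.
have sa E' : nth 0 E' a = va -> spec E' (TVar a) va by move=> ?; apply: spec_var => //; lia.
have s1 E' : spec E' (TCst 1) 1 by apply: spec_cst.
have se E' e' : nth 0 E' e' = ve -> spec E' (TOp Add (TVar e') (TCst 1)) ve.+1.
  move=> He; rewrite -[ve.+1]addn1; apply: spec_add => //; last by lia.
  by apply: spec_var => //; lia.
apply: (@spec_eq _ _ _ _ _ (((va < Q) && has (fun i => digit n va i == ve.+1) (iota 0 s)) ||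
    ((Q <= va) && nth false x ((va - Q).+1 * n.+1 + ve.+1)))).
  rewrite /set_at; case: ltnP => vaQ /=; first by rewrite inE orbF.
  by rewrite (row_x (Ordinal en)) //; lia.
apply: spec_or => //; apply: spec_and => //.
- by apply: spec_lt; [|apply: sa|apply: spec_Q].
- apply: spec_ex => //; first by apply: spec_cst; lia.
  move=> i si; apply: spec_eqn => //; last by apply: se.
  apply: spec_mod; [|exact: spec_n1]; apply: spec_div; first by apply: spec_var => //; lia.
  apply: (@spec_pow _ _ _ _ _ _ _ _ n) => //; first by move=> j; apply: spec_n1.
    by apply: spec_var => //; lia.
  by apply: leq_trans QM; rewrite leq_pexp2l //; lia.
- by apply: spec_le; [|apply: spec_Q|apply: sa].
- have le : (va - Q).+1 * n.+1 + ve.+1 <= M.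
    apply: leq_trans AM; apply: leq_add; last by lia.
    by rewrite leq_mul2r; lia.
  apply: spec_read => //; apply: spec_add => //; last exact: se.
  apply: spec_mul; [|exact: spec_n1|lia].
  rewrite -[(va - Q).+1]addn1; apply: spec_add => //; last by lia.
  by apply: spec_sub; [apply: sa|apply: spec_Q].
Qed.

Lemma spec_subset E a b : nth 0 E a < A -> nth 0 E b < A ->
  spec E (Tsub a b) (set_at (nth 0 E a) \subset set_at (nth 0 E b)).
Proof.
move=> aA bA.
pose P i := if insub i is Some e then
  (e \in set_at (nth 0 E a)) ==> (e \in set_at (nth 0 E b)) else false.
apply: (@spec_eq _ _ _ _ _ (all P (iota 0 n))).
  rewrite all_iota_ord; congr nat_of_bool; apply/forallP/subsetP => [H e eX|H e].
    by have := H e; rewrite /P valK eX.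
  by rewrite /P valK; apply/implyP/H.
apply: spec_all => //; first exact: spec_n.
move=> i i_n; rewrite /P (insubT (gtn n) i_n); apply: spec_imp => //.
  exact: (@spec_mem (i :: E) a.+1 0).
exact: (@spec_mem (i :: E) b.+1 0).
Qed.

Lemma spec_proper E a b : nth 0 E a < A -> nth 0 E b < A ->
  spec E (Tproper a b) (set_at (nth 0 E a) \proper set_at (nth 0 E b)).
Proof.
move=> aA bA; rewrite properE; apply: spec_and => //; first exact: spec_subset.
by apply: spec_not => //; apply: spec_subset.
Qed.

Lemma spec_size E a : nth 0 E a < A -> spec E (Tsize a) #|set_at (nth 0 E a)|.
Proof.
move=> aA.
pose P i := if insub i is Some e then e \in set_at (nth 0 E a) else false.
apply: (@spec_eq _ _ _ _ _ (count P (iota 0 n))).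
  by rewrite count_iota_ord; apply: eq_card => e; rewrite inE /P valK.
apply: spec_count => //; first exact: spec_n.
move=> i i_n; rewrite /P (insubT (gtn n) i_n).
exact: (@spec_mem (i :: E) a.+1 0).
Qed.

Lemma spec_fresh E a : nth 0 E a < A -> spec E (Tfresh a) (fresh (nth 0 E a)).
Proof.
move=> aA; apply: spec_all => //; first exact: spec_A.
move=> i iA; apply: spec_not => //; apply: spec_and => //.
  by apply: spec_lt => //; apply: spec_var => //=; lia.
rewrite eqEsubset; apply: spec_and => //.
  exact: (@spec_subset (i :: E) a.+1 0).
exact: (@spec_subset (i :: E) 0 a.+1).
Qed.

Definition spec_pred (T : nat -> tm) (p : pred {set 'I_n}) :=
  forall E c, nth 0 E c < A -> spec E (T c) (p (set_at (nth 0 E c))).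

Lemma spec_branch T p E c a : spec_pred T p -> (forall X, p X -> #|X| <= s) ->
  nth 0 E c < A -> nth 0 E a < A ->
  spec E (Tbranch T c a)
    (fresh (nth 0 E a) && branch F p (set_at (nth 0 E c)) (set_at (nth 0 E a))).
Proof.
move=> sT ps cA aA; set C := set_at (nth 0 E c); set X := set_at (nth 0 E a).
pose P d := ~~ [&& C \proper set_at d, set_at d \proper X & p (set_at d)].
apply: (@spec_eq _ _ _ _ _ [&& fresh (nth 0 E a), C \subset X, all P (iota 0 A)
    & (Q <= nth 0 E a) || ~~ (X \subset C) && p X]).
  congr nat_of_bool; case fa: (fresh _) => //=; rewrite /branch.
  case CX: (C \subset X) => //=; congr (_ && _).
    (* The term quantifies over indices only; this loses nothing, as a set satisfying [p] has at
       most [s] elements and so has an index. *)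
    apply/allP/forallP => [H D|H d _]; last exact: H.
    apply/negP => /and3P[CD DX pD].
    have [d [dA fd eD]] := fresh_exists (or_intror (ps D pD)).
    have := H d; rewrite mem_iota dA => /(_ isT).
    by rewrite /P eD CD DX pD.
  (* For a fresh index, being a row means membership in [F]; given [C \subset X], distinctness is
     failure of the reverse inclusion. *)
  rewrite set_at_row // eqEsubset CX /=.
  by [].
apply: spec_and => //; first exact: spec_fresh.
apply: spec_and => //; first exact: spec_subset.
apply: spec_and => //.
  apply: spec_all => //; first exact: spec_A.
  move=> i iA; apply: spec_not => //; apply: spec_and => //.
    exact: (@spec_proper (i :: E) c.+1 0).
  apply: spec_and => //; first exact: (@spec_proper (i :: E) 0 a.+1).
  exact: (sT (i :: E) 0).
apply: spec_or => //.
  by apply: spec_le => //; [apply: spec_Q|apply: spec_var => //; lia].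
apply: spec_and => //; last exact: sT.
by apply: spec_not => //; apply: spec_subset.
Qed.

Lemma spec_forced f : spec_pred (Tforced f) (forced_fuel s k F f).
Proof.
elim: f => [|f IH] E c cA; first exact: spec_cst.
have sz := spec_size cA.
have ps := @forced_fuel_card f.
apply: spec_and => //; first by apply: spec_le => //; apply: spec_cst; lia.
apply: spec_lt => //.
  apply: (@spec_pow _ _ _ _ _ _ _ _ n) => //; first by move=> i; apply: spec_k.
  - by apply: spec_sub => //; apply: spec_cst.
  - by lia.
  - by apply: leq_trans QM; rewrite leq_pexp2l // leq_subr.
rewrite -count_fresh; last by move=> X; apply: branch_small ps.
apply: spec_count => //; first exact: spec_A.
by move=> i iA; apply: (@spec_branch _ _ (i :: E) c.+1 0).
Qed.

Lemma spec_kernel E c a : nth 0 E c = 0 -> nth 0 E a < A ->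
  spec E (Tkernel c a) (fresh (nth 0 E a) && (set_at (nth 0 E a) \in K)).
Proof.
move=> c0 aA; have cA : nth 0 E c < A by rewrite c0 addn_gt0 expn_gt0.
have := spec_branch (@spec_forced s.+1) (@forced_fuel_card s.+1) cA aA.
by rewrite c0 set_at0 /kernel /branches inE.
Qed.

Lemma spec_deg E c e : nth 0 E c = 0 -> forall en : nth 0 E e < n,
  spec E (Tdeg c e) (degree K (Ordinal en)).
Proof.
move=> c0 en.
rewrite /degree -(count_fresh (p := fun X => (X \in K) && (Ordinal en \in X))); last first.
  by move=> X /andP[/kernel_small].
apply: (@spec_eq _ _ _ _ _ (count (fun a => (fresh a && (set_at a \in K)) &&
    (Ordinal en \in set_at a)) (iota 0 A))).
  by apply: eq_count => a; rewrite andbA.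
apply: spec_count => //; first exact: spec_A.
move=> i iA; apply: spec_and => //; first exact: (@spec_kernel (i :: E) c.+1 0).
exact: (@spec_mem (i :: E) 0 e.+1).
Qed.

Lemma spec_keep E c a e : nth 0 E c = 0 -> nth 0 E a < A -> forall en : nth 0 E e < n,
  spec E (Tkeep c a e) (Ordinal en \in trim K (set_at (nth 0 E a))).
Proof.
move=> c0 aA en; rewrite inE; set X := set_at _; apply: spec_and => //; first exact: spec_mem.
apply: spec_or => //.
  by apply: spec_lt => //; [apply: spec_cst|apply: spec_deg].
pose P i := if insub i is Some e' then ~~ ((e' \in X) && (degree K e' <= 1)) else false.
apply: (@spec_eq _ _ _ _ _ (all P (iota 0 (nth 0 E e)))).
  congr nat_of_bool; apply/allP/forallP => [H e'|H i].
    apply/implyP => ee; have := H e'; rewrite mem_iota ee => /(_ isT).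
    by rewrite /P valK.
  rewrite mem_iota /= => ie; have i_n : i < n by lia.
  by rewrite /P (insubT (gtn n) i_n); have /implyP := H (Ordinal i_n); apply.
apply: spec_all => //; first by apply: spec_var => //; lia.
move=> i ie; have i_n : i < n by lia.
rewrite /P (insubT (gtn n) i_n); apply: spec_not => //; apply: spec_and => //.
  exact: (@spec_mem (i :: E) a.+1 0).
apply: spec_le => //; last exact: spec_cst.
exact: (@spec_deg (i :: E) c.+1 0).
Qed.

Definition out_rows : seq {set 'I_n} :=
  [seq trim K (set_at a) | a <- fresh_list (mem K)].

Lemma spec_main : sspec M x [:: n; m; k] [::] Smain
  (if forced s k F set0 then [:: false] else true :: encode out_rows k).
Proof.
have A0 : 0 < A by rewrite addn_gt0 expn_gt0.
have s1 E : tspec M x [:: n; m; k] E (TCst 1) true by apply: spec_cst.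
have s0 E : tspec M x [:: n; m; k] E (TCst 0) false by apply: spec_cst.
have sn E : tspec M x [:: n; m; k] E Tn n by exact: spec_n.
(* The outer loop runs once, so its output is that of the body followed by the empty string. *)
rewrite -[X in sspec _ _ _ _ _ X]cats0.
apply: (@sspec_for _ _ _ _ _ _ 1 (fun=> if forced s k F set0 then [:: false]
  else true :: encode out_rows k)) => // i i1.
have {i1} -> : i = 0 by lia.
apply: sspec_if.
- rewrite -set_at0.
  exact: (@spec_forced s.+1 [:: 0] 0).
- exact: sspec_emit.
have -> : true :: encode out_rows k = [:: true] ++ (nseq n true ++ ([:: false] ++
   (flatten [seq true :: row_bits X | X <- out_rows] ++
   ([:: false] ++ (nseq k true ++ [:: false]))))).
  by rewrite /encode /unary -!cats1 -!catA.
apply: sspec_seq; first exact: sspec_emit.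
apply: sspec_seq; first by rewrite -flatten_nseq; apply: sspec_for => // j _; apply: sspec_emit.
apply: sspec_seq; first exact: sspec_emit.
apply: sspec_seq; last first.
  apply: sspec_seq; first exact: sspec_emit.
  apply: sspec_seq; last exact: sspec_emit.
  rewrite -flatten_nseq; apply: sspec_for => [|j _]; last exact: sspec_emit.
  exact: spec_k.
rewrite /out_rows -map_comp -flatten_if.
apply: sspec_for => [|a aA]; first exact: spec_A.
apply: sspec_if.
- exact: (@spec_kernel [:: a; 0] 1 0).
- rewrite [X in sspec _ _ _ _ _ X]/= -[X in sspec _ _ _ _ _ X]cat1s.
  apply: sspec_seq; first exact: sspec_emit.
  rewrite row_bitsE; apply: sspec_for => // e en; apply: sspec_emit.
  rewrite (insubT (gtn n) en).
  exact: (@spec_keep [:: e; a; 0] 2 1 0).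
- by apply/sspecP.
Qed.

End Program.

(** * Reading the input *)

(** The prefix up to [i] satisfies [b] exactly when [i < v]. Nothing is asked of [b v] when the
    initial run fills the whole range. *)
Lemma count_prefix (b : pred nat) v Bd :
  (forall j, j < v -> b j) -> (v < Bd -> ~~ b v) -> v <= Bd ->
  count (fun i => all b (iota 0 i.+1)) (iota 0 Bd) = v.
Proof.
move=> bt bf vB.
have -> : count (fun i => all b (iota 0 i.+1)) (iota 0 Bd) = count (gtn v) (iota 0 Bd).
  apply: eq_in_count => i; rewrite mem_iota => /andP[_ iB].
  apply/allP/idP => [H|iv j]; last by rewrite mem_iota => ?; apply: bt; move: iv => /=; lia.
  rewrite /= ltnNge; apply/negP => vi; have /negP := bf (leq_ltn_trans vi iB); apply.
  by apply: H; rewrite mem_iota; lia.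
rewrite -(subnKC vB) iotaD count_cat -[RHS]addn0; congr (_ + _).
  rewrite -[RHS](size_iota 0); apply/eqP; rewrite -all_count.
  by apply/allP => j; rewrite mem_iota /=; lia.
rewrite -[RHS](count_pred0 (iota (0 + v) (Bd - v))).
apply: eq_in_count => j; rewrite mem_iota /=; lia.
Qed.

Section Input.

Variables (n k0 : nat) (r : seq {set 'I_n}).
Let x := encode r k0.
Let m := size r.

Lemma nth_flatten_blocks (w : nat) (ss : seq (seq bool)) tl i j :
  all (fun l => size l == w) ss -> i < size ss -> j < w ->
  nth false (flatten ss ++ tl) (i * w + j) = nth false (nth [::] ss i) j.
Proof.
elim: ss i => //= l ss IH i /andP[/eqP sl al]; rewrite -catA nth_cat sl.
case: i => [_ jw|i ii jw]; first by rewrite mul0n add0n jw.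
rewrite mulSn -addnA ltnNge leq_addr /= addKn; exact: IH.
Qed.

Lemma size_flatten_blocks (w : nat) (ss : seq (seq bool)) :
  all (fun l => size l == w) ss -> size (flatten ss) = size ss * w.
Proof. by elim: ss => //= l ss IH /andP[/eqP sl /IH]; rewrite size_cat sl mulSn => ->. Qed.

Let blocks := [seq true :: row_bits X | X <- r].

Let size_blocks : all (fun l => size l == n.+1) blocks.
Proof. by apply/allP => _ /mapP[X _ ->] /=; rewrite size_map size_enum_ord. Qed.

Lemma nth_unary a tl i :
  nth false (unary a ++ tl) i = if i <= a then i < a else nth false tl (i - a.+1).
Proof.
rewrite nth_cat size_rcons size_nseq ltnS; case: (leqP i a) => // ia.
by rewrite nth_rcons size_nseq nth_nseq; case: (ltnP i a) => // _; case: ifP.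
Qed.

Lemma nth_input_univ i : i <= n -> nth false x i = (i < n).
Proof. by move=> le; rewrite nth_unary le. Qed.

Lemma nth_input_rows i : nth false x (n.+1 + i) =
  nth false (flatten blocks ++ false :: unary k0) i.
Proof. by rewrite nth_unary leqNgt ltnS leq_addr /= addKn. Qed.

Lemma nth_input_mark i : i < m -> nth false x (i.+1 * n.+1).
Proof.
move=> im; rewrite mulSn nth_input_rows -[i * _]addn0 nth_flatten_blocks ?size_map //.
by rewrite (nth_map set0).
Qed.

Lemma nth_input_row i (e : 'I_n) : i < m ->
  nth false x (i.+1 * n.+1 + e.+1) = (e \in nth set0 r i).
Proof.
move=> im; rewrite mulSn -addnA nth_input_rows nth_flatten_blocks ?size_map //=;
  last by rewrite ltnS.
by rewrite (nth_map set0) //= (nth_map e) ?size_enum_ord // nth_ord_enum.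
Qed.

(** The end marker stands where the marker of one more row would be, so the count of rows stops
    there. *)
Lemma nth_input_tail i : nth false x (m.+1 * n.+1 + i) = nth false (false :: unary k0) i.
Proof.
rewrite mulSn -addnA nth_input_rows nth_cat (size_flatten_blocks size_blocks) size_map.
by rewrite ltnNge leq_addr /= addKn.
Qed.

Variables (s M : nat).
Hypothesis m_le : m <= n.+1 ^ s.+1.
Hypothesis M_ge : (n.+1 ^ s.+1).+1 * n.+1 + n.+1 <= M.
Hypothesis sM : s.+1 <= M.

Let M_gt0 : 0 < M. Proof. exact: leq_trans sM. Qed.
Let QM : n.+1 ^ s.+1 < M.
Proof. by have := M_ge; rewrite mulnS; lia. Qed.
Let nM : n.+1 <= M. Proof. by apply: leq_trans M_ge; rewrite leq_addl. Qed.

Lemma spec_succ_var g E i v : nth 0 E i = v -> v < M ->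
  tspec M x g E (TOp Add (TVar i) (TCst 1)) v.+1.
Proof.
move=> Ev vM; rewrite -[v.+1]addn1; apply: spec_add; rewrite ?addn1 //; last exact: spec_cst.
by apply: spec_var => //; apply: ltnW.
Qed.

Lemma spec_succ_n g E : nth 0 g 0 = n -> tspec M x g E Tn1 n.+1.
Proof.
move=> gn; rewrite -addn1; apply: spec_add; rewrite ?addn1 //; last exact: spec_cst.
by apply: spec_glob => //; apply: ltnW.
Qed.

Lemma spec_rows : tspec M x [:: n; 0; 0] [::] (Trows s) m.
Proof.
rewrite -[X in tspec _ _ _ _ _ X](@count_prefix (fun j => nth false x (j.+1 * n.+1)) m
  (n.+1 ^ s.+1)) //; first last.
- by move=> _; rewrite -[_ * _]addn0 nth_input_tail.
- exact: nth_input_mark.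
apply: spec_count => //.
  apply: (@spec_pow _ _ _ _ _ _ _ _ n) => //; last exact: ltnW.
    by move=> i; apply: spec_succ_n.
  exact: spec_cst.
move=> i iQ; apply: spec_all => //; first by apply: spec_succ_var => //; lia.
move=> j ji; apply: spec_read => //; apply: spec_mul; [|exact: spec_succ_n|].
  by apply: spec_succ_var => //; lia.
apply: leq_trans M_ge; apply: leq_trans (leq_addr _ _); rewrite leq_mul2r; lia.
Qed.

Lemma spec_budget : tspec M x [:: n; m; 0] [::] Tbudget (minn k0 n).
Proof.
rewrite -[X in tspec _ _ _ _ _ X](@count_prefix
  (fun j => nth false x (j + (m.+1 * n.+1 + 1))) (minn k0 n) n) ?geq_minr //; first last.
- move=> lt; have -> : minn k0 n = k0 by lia.
  rewrite addnC -addnA nth_input_tail /= -[unary k0]cats0 nth_unary leqnn.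
  by rewrite ltnn.
- move=> j jk; rewrite addnC -addnA nth_input_tail /= -[unary k0]cats0 nth_unary.
  by rewrite add0n ifT; lia.
apply: spec_count => //; first by apply: spec_glob => //; lia.
move=> i i_n; apply: spec_all => //; first by apply: spec_succ_var => //; lia.
have le : m.+1 * n.+1 <= (n.+1 ^ s.+1).+1 * n.+1 by rewrite leq_mul2r; lia.
move=> j ji; apply: spec_read => //; apply: spec_add; first by apply: spec_var => //; lia.
  apply: spec_add; last by lia.
    apply: spec_mul; [|exact: spec_succ_n|lia].
    rewrite -[m.+1]addn1; apply: spec_add; [|exact: spec_cst|lia].
    by apply: spec_glob => //; lia.
  exact: spec_cst.
by lia.
Qed.

End Input.

(** * The complete program and its execution *)

(** The universe size cannot come from a bounded count, as nothing is known yet to bound it by; a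
    [While] loop scans the unary prefix instead. *)
Definition read_univ (N : nat) : cmd 'I_N.+1 :=
  Seq (Assign (inord 3) (ReadAt (inord 0)))
    (While (inord 3) (Seq (set_const N 4 1) (Seq (set_op N 0 Add 0 4)
      (Assign (inord 3) (ReadAt (inord 0)))))).

Definition kernelize (s N : nat) : cmd 'I_N.+1 :=
  Seq (read_univ N)
    (Seq (tcomp N [::] 3 (Trows s)) (Seq (set_copy N 1 3)
      (Seq (tcomp N [::] 3 Tbudget) (Seq (set_copy N 2 3)
        (scomp N [::] 3 (Smain s)))))).

Section Run.

Variables (N B M s n k0 : nat) (r : seq {set 'I_n}).
Let x := encode r k0.
Let m := size r.
Let k := minn k0 n.
Local Notation reg i := (inord i : 'I_N.+1).

Hypothesis m_le : m <= n.+1 ^ s.+1.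
Hypothesis sM : s.+1 <= M.
Hypothesis QM : (n.+1 ^ s.+1).+1 * n.+1 + n.+1 <= M.
Hypothesis AM : (n.+1 ^ s + m).+1 * n.+1 + n.+1 <= M.
Hypothesis NB : N.+1 * nbits M <= B.
Hypothesis sN : 40 * s + 140 <= N.

Lemma runs_read_univ : runs x B M (read_univ N) (store0 'I_N.+1) [::]
  (fun st => [/\ st (reg 0) = n, st (reg 1) = 0 & st (reg 2) = 0]).
Proof.
have M_gt0 : 0 < M by lia.
have N4 : 4 <= N by lia.
have nM : n < M by lia.
have b0 : bounded_store M (store0 'I_N.+1) by move=> v; rewrite ffunE.
pose P i (st : store 'I_N.+1) := [/\ st (reg 0) = i, st (reg 1) = 0, st (reg 2) = 0
  & st (reg 3) = nth false x i].
apply: (@runs_seq0 _ _ _ _ _ _ _ _ (P 0)).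
  apply: runs_assign => //=; first by case: nth.
  by split; rewrite get_update ?ffunE //; lia.
move=> st1 bs1 P1.
have -> : [::] = flatten [seq (fun _ : nat => [::] : seq bool) i | i <- iota 0 n].
  by elim: (iota 0 n).
suff HP : runs x B M (While (reg 3) (Seq (set_const N 4 1) (Seq (set_op N 0 Add 0 4)
      (Assign (inord 3) (ReadAt (inord 0)))))) st1
      (flatten [seq (fun _ : nat => [::] : seq bool) i | i <- iota 0 n]) (P n).
  by apply: (runs_weaken HP) => st' [].
apply: runs_countdown => //.
- move=> i st i_n [_ _ _ ->]; rewrite nth_input_univ //.
  by case: (i < n).
- move=> i st i_n bs [p0 p1 p2 _].
  apply: runs_seq0.
    by apply: (@runs_const _ _ _ _ NB _ _ _ (fun st' => forall q, q <= N ->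
      st' (reg q) = if q == 4 then 1 else st (reg q))).
  move=> st2 bs2 k2.
  have e4 : st2 (reg 4) = 1 by rewrite k2.
  have e0 : st2 (reg 0) = i by rewrite k2.
  apply: runs_seq0.
    apply: (@runs_op _ _ _ _ NB _ _ _ _ _ (fun st' => forall q, q <= N ->
      st' (reg q) = if q == 0 then i.+1 else st2 (reg q))) => //.
      by rewrite e0 e4 /= addn1; lia.
    by move=> st' k' q qN; rewrite k' // e0 e4 /= addn1.
  move=> st3 bs3 k3.
  apply: runs_assign => //=; first by case: nth.
  by split; rewrite get_update //= ?k3 ?k2 //=; lia.
Qed.

(** The globals are filled one at a time: the row count is found from [n], the capped budget from
    both, and then the main statement runs. *)
Lemma runs_kernelize : runs x B M (kernelize s N) (store0 'I_N.+1)
  (if forced s k [set S in r] set0 then [:: false]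
   else true :: encode (out_rows s m k r) k) (fun=> True).
Proof.
have M_gt0 : 0 < M by lia.
have N4 : 4 <= N by lia.
apply: runs_seq0; first exact: runs_read_univ.
move=> st1 bs1 [g0 g1 g2].
have mod1 : models [:: n; 0; 0] [::] [::] 3 st1.
  by split=> //; case=> [|[|[|i]]].
have /tspecP[tb1 te1 _] := @spec_rows n k0 r s M m_le QM sM.
apply: runs_seq0.
  apply: (tcomp_correct M_gt0 NB bs1 mod1) => //.
  by have := tdepth_rows s; lia.
move=> st2 bs2 [v2 k2]; rewrite te1 in v2.
apply: runs_seq0.
  apply: (@runs_copy _ _ _ _ NB _ _ _ (fun st' => forall q, q <= N ->
    st' (reg q) = if q == 1 then m else st2 (reg q))) => //; try lia.
  by move=> st' k' q qN; rewrite k' // v2.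
move=> st3 bs3 k3.
have mod3 : models [:: n; m; 0] [::] [::] 3 st3.
  by split=> //; case=> [|[|[|i]]] // _; rewrite k3 ?k2 //; lia.
have /tspecP[tb3 te3 _] := @spec_budget n k0 r s M m_le QM sM.
apply: runs_seq0.
  apply: (tcomp_correct M_gt0 NB bs3 mod3) => //.
  by have := tdepth_budget; lia.
move=> st4 bs4 [v4 k4]; rewrite te3 in v4.
apply: runs_seq0.
  apply: (@runs_copy _ _ _ _ NB _ _ _ (fun st' => forall q, q <= N ->
    st' (reg q) = if q == 2 then k else st4 (reg q))) => //; try lia.
  by move=> st' k' q qN; rewrite k' // v4.
move=> st5 bs5 k5.
have mod5 : models [:: n; m; k] [::] [::] 3 st5.
  by split=> //; case=> [|[|[|i]]] // _; rewrite k5 ?k4 ?k3 ?k2 //; lia.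
have QM' : n.+1 ^ s.+1 <= M by move: QM; rewrite mulnS; lia.
have /sspecP[sb <-] := @spec_main s n m k M x r erefl
  (fun i e im => @nth_input_row n k0 r i e im) (geq_minr _ _) sM QM' AM.
apply: runs_weaken (scomp_correct M_gt0 NB bs5 mod5 _ sb) _ => //.
by have := sdepth_main s; lia.
Qed.

End Run.

(** * Space bound and conclusion *)

(** From [n < 2 ^ nbits n] follows [n.+2 <= 2 ^ (nbits n).+1], and the exponent is at most
    [2 * nbits n]. *)
Lemma nbits_pow n e : nbits (n.+2 ^ e) <= (2 * e).+1 * nbits n.
Proof.
have lt : n.+2 <= 2 ^ (2 * nbits n).
  have n2 : n < 2 ^ nbits n by apply: trunc_log_ltn.
  have : 2 ^ (nbits n).+1 <= 2 ^ (2 * nbits n) by rewrite leq_exp2l // /nbits; lia.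
  apply: leq_trans; rewrite expnS; have : 0 < 2 ^ nbits n by rewrite expn_gt0.
  by lia.
have le : trunc_log 2 (n.+2 ^ e) <= 2 * nbits n * e.
  rewrite -[X in _ <= X](@trunc_expnK 2) //; apply: leq_trunc_log.
  by rewrite expnM; apply: leq_pow2.
have b0 : 0 < nbits n by [].
by rewrite {1}/nbits mulSn; lia.
Qed.

Lemma space_bound s n : 0 < s ->
  (40 * s + 140).+1 * nbits (n.+2 ^ (s + 4)) <= 2000 * s ^ 2 * nbits n.
Proof.
move=> s0; have := nbits_pow n (s + 4); set b := nbits n; set c := nbits _ => cb.
(* As [s >= 1], there are at most [181 * s] registers of at most [11 * s * b] bits, and
   [181 * 11 = 1991]. *)
apply: (@leq_trans ((181 * s) * (11 * s * b))).
  apply: leq_mul; first by lia.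
  by apply: leq_trans cb _; rewrite leq_mul2r; apply/orP; right; lia.
rewrite -mulnn; nia.
Qed.

Theorem theorem3 :
  exists c : nat, forall s : nat, 1 <= s ->
  exists (V : finType) (p : cmd V),
  forall (I : hs_instance) (x : seq bool),
    pairwise_meet_le s I -> encodes x I ->
    exists out : seq bool,
      runs_in_space p x (c * s ^ 2 * nbits (univ I)) out /\
      ((answers_no out /\ ~ hs_yes I) \/
       exists J : hs_instance,
         answers_instance out J /\
         [/\ hs_equiv I J,
             #|fam J| <= budget I ^ s.+1,
             (forall S, S \in fam J -> #|S| <= s * budget I ^ s.+1)
           & pairwise_meet_le s J]).
Proof.
exists 2000 => s s0; exists 'I_(40 * s + 140).+1, (kernelize s (40 * s + 140)).
case=> n F k0 x; rewrite /pairwise_meet_le /encodes /= => Fm [r [r_uniq rF ->]].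
have eF : F = [set S in r] by apply/setP => S; rewrite inE rF.
(* Capping the budget at [n] changes no answer, since no subset of the universe has more than [n]
   elements. *)
subst F; pose F := [set S in r]; pose k := minn k0 n; pose K := kernel s k F.
have Fmeet : forall A B, A \in F -> B \in F -> A != B -> #|A :&: B| <= s := Fm.
have m_le : size r <= n.+1 ^ s.+1.
  rewrite -(card_uniqP r_uniq) -cardsE; exact: card_meet_family Fmeet.
(* The base [n.+2] is at least 2, so [M] exceeds [s] even for [n = 0]; the three factors beyond
   [n.+2 ^ s.+1] leave room for input addresses. *)
pose M := n.+2 ^ (s + 4).
have PM c : c <= 2 * n.+2 ^ s.+1 -> c.+1 * n.+1 + n.+1 <= M.
  move=> cP; have P0 : 0 < n.+2 ^ s.+1 by rewrite expn_gt0.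
  rewrite /M (_ : s + 4 = s.+1 + 3); last by lia.
  rewrite expnD; set P := n.+2 ^ s.+1 in cP P0 *.
  apply: (@leq_trans (4 * P * n.+2)); first by nia.
  rewrite [4 * P]mulnC -mulnA leq_mul2l expnS [4 * _]mulnC leq_mul2l -mulnn.
  by apply/orP; right; rewrite /=; nia.
have Q_le t : t <= s.+1 -> n.+1 ^ t <= n.+2 ^ s.+1.
  move=> ts; apply: (@leq_trans (n.+2 ^ t)); first exact: leq_pow2.
  by rewrite leq_pexp2l.
have sM : s.+1 <= M.
  apply: (@leq_trans (2 ^ (s + 4))); last exact: leq_pow2.
  by apply: leq_trans (_ : s + 4 < _); [lia|apply: ltn_expl].
have QM : (n.+1 ^ s.+1).+1 * n.+1 + n.+1 <= M.
  by apply: PM; have := Q_le s.+1 (leqnn _); lia.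
have AM : (n.+1 ^ s + size r).+1 * n.+1 + n.+1 <= M.
  by apply: PM; have := Q_le s (leqnSn _); have := Q_le s.+1 (leqnn _); lia.
have [st [ex _ _]] := runs_kernelize k0 m_le sM QM AM (space_bound n s0) (leqnn _).
have st0 : store_bits (store0 'I_(40 * s + 140).+1) <= 2000 * s ^ 2 * nbits n.
  apply: (bounded_store_bits (space_bound n s0)) => v; rewrite ffunE.
  by [].
eexists; split; first by split; [exact: st0|exists st; exact: ex].
rewrite -/k -/F.
have yesk (H : {set 'I_n}) : #|H| <= k0 -> #|H| <= k.
  by move=> Hk; rewrite leq_min Hk -[X in _ <= X]card_ord max_card.
have kk0 : k <= k0 by apply: geq_minl.
(* If the empty set is forced, a hitting set within the budget would have to meet it. *)
case: ifP => fo; [left|right].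
  split=> // -[H [/= /yesk Hk HF]].
  by have := forced_hit Fmeet Hk HF fo; rewrite setI0 eqxx.
(* That the empty set is not forced is exactly the bound on the number of its branches. *)
have cK : #|K| <= k ^ s.+1.
  by move/negbT: fo; rewrite forcedE cards0 /= subn0 -leqNgt.
have cK0 : #|K| <= k0 ^ s.+1 by apply: leq_trans cK _; apply: leq_pow2.
have Kmeet := kernel_meet (k := k) Fmeet.
have out_memP X : (X \in out_rows s (size r) k r) = (X \in trim K @: K).
  apply/mapP/imsetP => [[a]|[Y YK ->]].
    by rewrite mem_filter => /andP[/andP[_ aK] _] ->; exists (set_at s r a).
  have : Y \in [seq set_at s r a | a <- fresh_list s (size r) r (mem K)].
    by rewrite mem_fresh_list //; apply: kernel_small.
  by case/mapP => a aK ->; exists a.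
exists (@HSInstance n (trim K @: K) k); split.
  exists (encode (out_rows s (size r) k r) k); split=> //; exists (out_rows s (size r) k r).
  split=> //.
  rewrite /out_rows (map_comp (trim K)) map_inj_in_uniq; first exact: fresh_list_uniq.
  move=> X Y; rewrite !mem_fresh_list //; try exact: kernel_small.
  exact: trim_inj.
split=> /=.
(* A hitting set of the input hits the kernel and is moved into the trimmed sets; conversely,
   hitting [trim X] hits [X]. *)
- split=> -[H [/= Hk HF]].
    have [H' [H'H H'K]] := trim_hit (hit_kernel Fmeet (yesk _ Hk) HF).
    exists H'; split=> /=; first exact: leq_trans H'H (yesk _ Hk).
    by move=> _ /imsetP[X XK ->]; apply: H'K.
  exists H; split=> /=; first exact: leq_trans kk0.
  apply: (kernel_hit (s := s) (k := k)) => X XK.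
  have /set0Pn[h /setIP[hH hX]] := HF _ (imset_f (trim K) XK).
  by apply/set0Pn; exists h; rewrite inE hH (subsetP (trim_sub K X)).
- exact: leq_trans (leq_imset_card _ _) cK0.
- move=> _ /imsetP[X XK ->]; apply: leq_trans (card_trim s0 Kmeet XK) _.
  by rewrite leq_mul2l cK0 orbT.
- move=> _ _ /imsetP[X XK ->] /imsetP[Y YK ->] XY.
  apply: leq_trans (Kmeet X Y XK YK _); last by apply: contraNneq XY => ->.
  by apply: subset_leq_card; apply: setISS; apply: trim_sub.
Qed.
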